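(* Let $l>0$, $m$, $\alpha$, $f$, $\sigma_1,\sigma_2,\sigma_3$, $l_1,l_2,l_3$ satisfy the standing assumptions listed in the context, where in particular $$\omega=\alpha+\left(\frac{\pi}{l}\right)^2-\frac{l}{\pi}\left(\frac{l}{\pi}\|\sigma_2\|_\infty+\|\sigma_3\|_\infty\right)>0 ,$$ and let $u$ be a solution of the boundary value problem $$u''''(x)-m\left(\int_0^l (u'(s))^2\,ds\right)u''(x)=f(x,u(x),u'(x)),\quad x\in(0,l),\qquad u(0)=u(l)=0,\quad u''(0)=u''(l)=0.$$ Let $u_0$ be an admissible initial approximation with $$\|u_0\|_1\le \frac{l}{\omega\pi}\|\sigma_1\| ,$$ and let $(u_k)_{k\ge 0}$ be the sequence of Picard iterates started from $u_0$ (defined in the context). Suppose that $$q=\frac{1}{\alpha+\left(\frac{\pi}{l}\right)^2}\left(\frac{l}{\pi}\right)^2\left(2l_1\left(\frac{\|\sigma_1\|}{\omega}\right)^2+\|l_2\|_\infty+\frac{\pi}{l}\|l_3\|_\infty\right)<1 .$$ Then the approximations $u_k$ converge to the exact solution $u$, and for the error the estimate $$\|u_k-u\|_p\le\left(\frac{l}{\pi}\right)^{1-p}q^k\,\|u_0-u\|_1,\qquad k=1,2,\dots,\quad p=0,1,$$ holds.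
   Context: Norms: $\|\cdot\|$ is the norm of $L_2(0,l)$, $\|\cdot\|_\infty$ the norm of $L_\infty(0,l)$, and $\|u\|_p=\left(\int_0^l\left(\frac{d^pu}{dx^p}(x)\right)^2dx\right)^{1/2}$ for $p=0,1,2$, so $\|u\|_0=\|u\|$. Standing assumptions. $l>0$. The function $m:[0,\infty)\to\mathbb{R}$ satisfies $m(z)\ge\alpha>0$ for all $z\ge0$ ($\alpha$ constant) and $|m(z_1)-m(z_2)|\le l_1|z_2-z_1|$ for all $z_1,z_2\ge 0$, with a constant $l_1>0$. The function $f:(0,l)\times\mathbb{R}\times\mathbb{R}\to\mathbb{R}$ is such that $f(\cdot,u,v)\in L_2(0,l)$ for all $u,v\in\mathbb{R}$, and for $0<x<l$ and all $u,v,u_i,v_i\in\mathbb{R}$, $$|f(x,u,v)|\le\sigma_1(x)+\sigma_2(x)|u|+\sigma_3(x)|v|,$$ $$|f(x,u_2,v_2)-f(x,u_1,v_1)|\le l_2(x)|u_2-u_1|+l_3(x)|v_2-v_1|,$$ where $\sigma_1\in L_2(0,l)$, $\sigma_2,\sigma_3,l_2,l_3\in L_\infty(0,l)$, $\sigma_1(x)\ge\mathrm{const}>0$, $\sigma_i(x)\ge0$, $l_i(x)>0$ for $i=2,3$. Moreover $\omega>0$, with $\omega$ as displayed in the claim. Solution: a solution of the boundary value problem is a function $u\in W^{2,2}(0,l)\cap W_0^{1,2}(0,l)$ satisfying the differential equation in the sense of distributions (so that $u''''\in L_2(0,l)$ and the boundary values of $u''$ make sense) together with the boundary conditions. It is assumed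 that a solution exists. Picard iterates: an admissible initial approximation is a function $u_0\in C^2[0,l]$ with $u_0(0)=u_0(l)=0$ and $u_0''(0)=u_0''(l)=0$. For $k=0,1,\dots$ put $\tau_k=m\left(\int_0^l (u_k'(x))^2dx\right)$ and $$u_{k+1}(x)=\int_0^l G_k(x,\xi)f(\xi,u_k(\xi),u_k'(\xi))\,d\xi,\qquad 0<x<l,$$ where $$G_k(x,\xi)=\frac1{\tau_k}\begin{cases}\frac1l(l-x)\xi+\frac{1}{\sqrt{\tau_k}\sinh(\sqrt{\tau_k}\,l)}\sinh(\sqrt{\tau_k}(x-l))\sinh(\sqrt{\tau_k}\,\xi),&0<\xi\le x<l,\\[2mm] \frac1l x(l-\xi)+\frac{1}{\sqrt{\tau_k}\sinh(\sqrt{\tau_k}\,l)}\sinh(\sqrt{\tau_k}\,x)\sinh(\sqrt{\tau_k}(\xi-l)),&0<x\le\xi<l.\end{cases}$$ *)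

(* Defs.v *)
From HB Require Import structures.
From mathcomp Require Import all_boot all_order all_algebra.
From mathcomp Require Import all_classical all_reals all_analysis.
Set Implicit Arguments.
Unset Strict Implicit.
Unset Printing Implicit Defensive.
Import Order.TTheory GRing.Theory Num.Theory.
Import numFieldNormedType.Exports.
Local Open Scope classical_set_scope.
Local Open Scope ring_scope.

(* Functions on (0,l) are represented by total functions R -> R whose values
   outside (0,l) (outside [0,l] for functions on the closed interval) never
   matter: every notion below restricts to that interval. *)

Section FunctionSpaces.
Context {R : realType}.
Implicit Types (l : R) (v g h phi : R -> R) (n : nat) (p : \bar R).
Local Notation leb := (@lebesgue_measure R).

(* Lfun asks for Borel measurability; passing to functions that agree a.e. with
   an element of Lfun gives all Lebesgue measurable ones, hence L_p as a space
   of functions considered up to null sets. *)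
Definition in_Lp l p g : Prop :=
  exists2 h : R -> R, h \_ `]0, l[ \in Lfun leb p
           & {ae leb, forall x : R, `]0, l[%classic x -> g x = h x}.

Definition Lp_norm l p g : R := fine (Lnorm leb p (EFin \o (g \_ `]0, l[))).

Definition test_function l phi : Prop :=
  let supp := closure [set x | phi x != 0] in
  [/\ forall n x, derivable (derive1n n phi) x 1,
      compact supp & supp `<=` `]0, l[].

(* The n-th distributional derivative of v is represented by g in L_2(0,l). *)
Definition is_weak_deriv l n v g : Prop :=
  in_Lp l 2%:E g /\
  forall phi, test_function l phi ->
    (-1) ^+ n * \int[leb]_(x in `]0, l[) (v x * derive1n n phi x) =
    \int[leb]_(x in `]0, l[) (g x * phi x).

(* d^n v / dx^n, determined only up to a null set; it is the zero function (junk)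
   when v has no n-th weak derivative in L_2(0,l). *)
Definition weak_deriv l n v : R -> R :=
  xget (cst 0) [set g | is_weak_deriv l n v g].

Definition sobolev_norm l n v : R :=
  Num.sqrt (\int[leb]_(x in `]0, l[) (weak_deriv l n v x) ^+ 2).

Definition in_sobolev l n v : Prop :=
  in_Lp l 2%:E v /\
  forall j, (j <= n)%N -> exists g, is_weak_deriv l j v g.

(* W_0^{1,2}(0,l): the closure of the test functions in W^{1,2}(0,l). *)
Definition in_W0 l v : Prop :=
  in_sobolev l 1 v /\
  exists2 phi : nat -> R -> R,
    forall i, test_function l (phi i)
    & forall j, (j <= 1)%N ->
        (fun i => sobolev_norm l j (phi i \- v)) @ \oo --> 0.

(* v(0) = v(l) = 0, read on the representative of v continuous on [0,l]. *)
Definition zero_boundary_values l v : Prop :=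
  exists w : R -> R,
    [/\ {within `[0, l], continuous w},
        {ae leb, forall x : R, `]0, l[%classic x -> v x = w x},
        w 0 = 0 & w l = 0].

(* Derivative on [0,l], one-sided at the end points. *)
Definition has_deriv_on l v g : Prop :=
  forall x : R, x \in `[0, l] ->
    (fun y => (v y - v x) / (y - x)) @ within `[0, l] x^' --> g x.

End FunctionSpaces.

Section BeamProblem.
Context {R : realType}.
Implicit Types (l alpha tau : R) (m u : R -> R) (f : R -> R -> R -> R).
Local Notation leb := (@lebesgue_measure R).

(* The differential equation is tested against phi, with all derivatives of the
   terms u'''' and u'' moved onto phi. *)
Definition is_solution l m f u : Prop :=
  let u' := weak_deriv l 1 u in
  let u'' := weak_deriv l 2 u in
  [/\ in_sobolev l 2 u, in_W0 l u,
      forall phi, test_function l phi ->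
        \int[leb]_(x in `]0, l[) (u x * derive1n 4 phi x)
        - m (\int[leb]_(s in `]0, l[) (u' s) ^+ 2)
          * \int[leb]_(x in `]0, l[) (u x * derive1n 2 phi x)
        = \int[leb]_(x in `]0, l[) (f x (u x) (u' x) * phi x),
      zero_boundary_values l u & zero_boundary_values l u''].

Definition admissible l (u0 : R -> R) : Prop :=
  exists u1 u2 : R -> R,
    [/\ has_deriv_on l u0 u1, has_deriv_on l u1 u2,
        {within `[0, l], continuous u2},
        u0 0 = 0 /\ u0 l = 0 & u2 0 = 0 /\ u2 l = 0].

Definition sinh (x : R) : R := (expR x - expR (- x)) / 2.

Definition green l tau (x xi : R) : R :=
  let s := Num.sqrt tau in
  tau^-1 *
  (if xi <= x then
     l^-1 * (l - x) * xi
     + (s * sinh (s * l))^-1 * sinh (s * (x - l)) * sinh (s * xi)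
   else
     l^-1 * x * (l - xi)
     + (s * sinh (s * l))^-1 * sinh (s * x) * sinh (s * (xi - l))).

Fixpoint picard l m f (u0 : R -> R) (k : nat) : R -> R :=
  if k is k'.+1 then
    let uk := picard l m f u0 k' in
    let tauk := m (\int[leb]_(x in `]0, l[) (derive1 uk x) ^+ 2) in
    fun x => \int[leb]_(xi in `]0, l[)
               (green l tauk x xi * f xi (uk xi) (derive1 uk xi))
  else u0.

Definition omega l alpha (sigma2 sigma3 : R -> R) : R :=
  alpha + (pi / l) ^+ 2
  - l / pi * (l / pi * Lp_norm l +oo%E sigma2 + Lp_norm l +oo%E sigma3).

Definition contraction_factor l alpha (l1 : R)
    (sigma1 sigma2 sigma3 l2 l3 : R -> R) : R :=
  (alpha + (pi / l) ^+ 2)^-1 * (l / pi) ^+ 2 *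
  (2 * l1 * (Lp_norm l 2%:E sigma1 / omega l alpha sigma2 sigma3) ^+ 2
   + Lp_norm l +oo%E l2 + pi / l * Lp_norm l +oo%E l3).

End BeamProblem.

(* Main.v *)
(* Integrated twice, the beam equation w'''' - tau w'' = g with its four boundary
   conditions reads w'' = tau w - K0 g, w(0) = w(l) = 0, where K0 is the Green
   operator of - d^2/dx^2; both the exact solution u (by a du Bois-Reymond lemma
   of order two) and the iterates (the kernel G_k is 1/tau_k times the difference
   of the Green functions of - d^2/dx^2 and of - d^2/dx^2 + tau_k) satisfy an
   equation of this form.  For the difference d of two such functions, multiplying
   the equation by d'' gives |d''|^2 + tau |d'|^2 = (d, g1 - g2) - (tau1 - tau2)(u', d').
   The sharp inequalities |d| <= l/pi |d'| and |d'| <= l/pi |d''| turn this into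
   (alpha + (pi/l)^2) |d'| <= l/pi |g1 - g2| + |tau1 - tau2| |u'|.  Against the
   zero function it yields the bound |w'| <= l |sigma1| / (omega pi) for u and,
   inductively, for the iterates; against u it then shows that one step
   multiplies |u_k' - u'| by at most q. *)

Require Import Defs.
From HB Require Import structures.
From mathcomp Require Import all_boot all_order all_algebra.
From mathcomp Require Import all_classical all_reals all_analysis.
From mathcomp Require Import measurable_realfun ess_sup_inf.
From mathcomp Require Import ring lra.
Set Implicit Arguments.
Unset Strict Implicit.
Unset Printing Implicit Defensive.
Import Order.TTheory GRing.Theory Num.Theory.
Import numFieldNormedType.Exports.
Local Open Scope classical_set_scope.
Local Open Scope ring_scope.

Import HBNNSimple.

(** The data [f x (v x) (v' x)] are only square integrable, so a fourth derivative exists only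
    almost everywhere, whereas K0 g is continuous; in the integrated form the unknowns are C^2
    inside the interval, and the energy identity needs nothing but integrations by parts of C^1
    functions and the symmetry of K0. Two obstacles shape the rest. The iteration differentiates its
    iterates classically although they are integrals of L_2 data; their regularity is obtained from
    weak formulations, never by differentiating an integral. And even the measurability of x |->
    f(x, v(x), v'(x)) has to be derived, with the help of the Lipschitz condition. The number omega
    is alpha + (pi/l)^2 minus the multiple of |w'| that the growth condition puts on the right, so
    absorbing that term divides by omega. In q, the term with l_1 comes from |tau1 - tau2| <= l_1
    |u_k' - u'| (|u_k'| + |u'|) and the a priori bound on both norms; the terms with l_2 and l_3
    come from the Lipschitz condition, l_2 paying a further l/pi because it multiplies |u_k - u|. *)

Lemma sintegral_restrict_null d (T : measurableType d) (R : realType)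
    (mu : {measure set T -> \bar R}) (N : set T) (f g : T -> \bar R) :
  measurable N -> mu N = 0%E -> (forall x, 0 <= g x)%E ->
  (forall x, ~ N x -> f x <= g x)%E ->
  (ereal_sup [set sintegral mu h | h in
     [set h : {nnsfun T >-> R} | forall x, (h x)%:E <= f x]] <=
   ereal_sup [set sintegral mu h | h in
     [set h : {nnsfun T >-> R} | forall x, (h x)%:E <= g x]])%E.
Proof.
move=> mN N0 g0 fg; apply: ge_ereal_sup => _ [h /= hf <-].
have mNC : measurable (~` N) by exact: measurableC.
(* Cutting [h] down to the complement of [N] puts it below [g] everywhere, by [g0] on [N], and
   leaves its integral unchanged. *)
apply: ereal_sup_ubound; exists (proj_nnsfun h mNC) => /=.
  move=> x; rewrite /proj_nnsfun /= mindicE.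
  have [xN|xN] := boolP (x \in ~` N).
    by rewrite mulr1 (le_trans (hf x))// fg//; move: xN; rewrite inE.
  by rewrite mulr0.
rewrite -!integralT_nnsfun.
apply: ge0_ae_eq_integral => //.
- exact/measurable_EFinP.
- exact/measurable_EFinP.
- by move=> x _; rewrite lee_fin.
- by move=> x _; rewrite lee_fin.
exists N; split => // x /=; apply: contra_notP => xN _.
by rewrite mindicE mem_set// mulr1.
Qed.

(* The integral of a function is defined without measurability, as the
   difference of two suprema over simple functions, and those suprema ignore
   null sets. *)
Lemma integral_ae d (T : measurableType d) (R : realType)
    (mu : {measure set T -> \bar R}) (D : set T) (f g : T -> \bar R) :
  {ae mu, forall x, D x -> f x = g x} ->
  (\int[mu]_(x in D) f x = \int[mu]_(x in D) g x)%E.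
Proof.
move=> [N [mN N0 sN]].
have fgE x : ~ N x -> (f \_ D) x = (g \_ D) x.
  move=> Nx; rewrite !patchE; case: ifPn => // /set_mem Dx.
  by apply: contrapT => fg; apply: Nx; apply: sN => /= /(_ Dx).
rewrite /integral; cbv zeta; congr (_ - _)%E; apply/eqP; rewrite eq_le; apply/andP; split;
  apply: (sintegral_restrict_null mN N0) => x //;
  by move=> /fgE; rewrite !(funeposE, funenegE) => ->.
Qed.

(** * Integrals and the sharp Wirtinger inequality *)

Section Basics.
Context {R : realType}.
Local Notation leb := (@lebesgue_measure R).
Implicit Types (l a b : R) (f g h F G : R -> R).

Lemma Rintegral_ae l f g :
  {ae leb, forall x : R, `]0, l[%classic x -> f x = g x} ->
  \int[leb]_(x in `]0, l[) f x = \int[leb]_(x in `]0, l[) g x.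
Proof.
move=> fg; congr fine; apply: integral_ae; case: fg => N [mN N0 sN].
exists N; split => // x /= fgx; apply: sN => /= H; apply: fgx => /H.
by move->.
Qed.

Definition intg (D : set (measurableTypeR R)) f := leb.-integrable D (EFin \o f).

Lemma eq_intg (D : set (measurableTypeR R)) f g : measurable D ->
  (forall x, D x -> f x = g x) -> intg D f -> intg D g.
Proof.
move=> mD fg; apply: eq_integrable => // x /set_mem Dx /=.
by rewrite fg.
Qed.

Lemma intgD (D : set (measurableTypeR R)) f g : measurable D ->
  intg D f -> intg D g -> intg D (fun x => f x + g x).
Proof. by move=> mD fi gi; have := (integrableD mD fi gi); apply: eq_integrable. Qed.

Lemma intgB (D : set (measurableTypeR R)) f g : measurable D ->
  intg D f -> intg D g -> intg D (fun x => f x - g x).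
Proof. by move=> mD fi gi; have := (integrableB mD fi gi); apply: eq_integrable. Qed.

Lemma intgZ (D : set (measurableTypeR R)) c f : measurable D ->
  intg D f -> intg D (fun x => c * f x).
Proof. by move=> mD fi; have := (integrableZl mD c fi); apply: eq_integrable. Qed.

Lemma intg_norm (D : set (measurableTypeR R)) f : measurable D ->
  intg D f -> intg D (fun x => `|f x|).
Proof. by move=> mD fi; exact: (integrable_abse fi). Qed.

Lemma intg_measurable (D : set (measurableTypeR R)) f : intg D f ->
  measurable_fun D (f : _ -> measurableTypeR R).
Proof. by move=> /(measurable_int _) /measurable_EFinP. Qed.

Lemma le_intg (D : set (measurableTypeR R)) f g : measurable D ->
  measurable_fun D (f : _ -> measurableTypeR R) ->
  (forall x, D x -> `|f x| <= g x) -> intg D g -> intg D f.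
Proof.
move=> mD mf fg; apply: le_integrable => //; first exact/measurable_EFinP.
move=> x Dx /=; rewrite lee_fin (le_trans (fg x Dx))// ler_norm//.
Qed.

Lemma intg_mul_bounded (D : set (measurableTypeR R)) (M : R) c f : measurable D ->
  measurable_fun D (c : _ -> measurableTypeR R) -> (forall x, D x -> `|c x| <= M) -> intg D f ->
  intg D (fun x => c x * f x).
Proof.
move=> mD mc cM fi; apply: (@le_intg D _ (fun x => M * `|f x|)) => //.
- by apply: measurable_funM => //; exact: intg_measurable.
- by move=> x Dx; rewrite normrM ler_wpM2r// cM.
- by apply: intgZ => //; exact: intg_norm.
Qed.

Lemma continuous_bounded_on_itv a b f : continuous f ->
  exists M, forall x, a <= x <= b -> `|f x| <= M.
Proof.
move=> cf; have [ab|ba] := leP a b; last first.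
  by exists 0 => x /andP[ax xb]; move: ba; rewrite ltNge (le_trans ax xb).
have cf' : {within `[a, b], continuous (fun x => `|f x|)}.
  apply: continuous_subspaceT => x.
  by apply: (continuous_comp (cf x)); exact: norm_continuous.
have [c _ cM] := EVT_max ab cf'.
by exists `|f c| => x xab; apply: cM; rewrite in_itv.
Qed.

Lemma intg_continuous a b f : continuous f -> intg `]a, b[ f.
Proof.
move=> cf; have : intg `[a, b] f.
  apply: continuous_compact_integrable; first exact: segment_compact.
  exact: continuous_subspaceT.
by apply: integrableS => //; exact: subset_itv_oo_cc.
Qed.

Lemma continuous_measurable_on (D : set (measurableTypeR R)) f : measurable D ->
  continuous f ->
  measurable_fun D (f : _ -> measurableTypeR R).
Proof.
by move=> mD cf; apply: measurable_funTS; exact: continuous_measurable_fun.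
Qed.

Lemma intg_mul_continuous a b c f : continuous (c : R -> R) -> intg `]a, b[ f ->
  intg `]a, b[ (fun x => c x * f x).
Proof.
move=> cc; have [M cM] := continuous_bounded_on_itv a b cc.
apply: (@intg_mul_bounded _ M) => //.
- exact: continuous_measurable_on.
- by move=> x /=; rewrite in_itv /= => /andP[? ?]; rewrite cM// !ltW.
Qed.

Lemma FTC2 a b F f : a < b -> continuous F -> continuous f ->
  (forall x, a < x < b -> is_derive x 1 F (f x)) ->
  \int[leb]_(x in `]a, b[) f x = F b - F a.
Proof.
move=> ab cF cf dF.
have intf : intg `[a, b] f.
  apply: continuous_compact_integrable; first exact: segment_compact.
  exact: continuous_subspaceT.
rewrite Rintegral_itv_obnd_cbnd; last first.
  by apply: integrableS intf => //; exact: subset_itv_oo_cc.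
rewrite Rintegral_itv_bndo_bndc; last first.
  by apply: integrableS intf => //; exact: subset_itv_co_cc.
rewrite /Rintegral (@continuous_FTC2 _ f F a b ab)//.
- exact: continuous_subspaceT.
- split.
  + by move=> x; rewrite in_itv /= => /dF [].
  + exact: cvg_at_right_filter (cF a).
  + exact: cvg_at_left_filter (cF b).
- move=> x; rewrite in_itv /= => /dF [dx <-].
  by rewrite derive1E.
Qed.


(* F is continuous, continuously differentiable on ]0, l[ with derivative f that
   extends continuously.  Asking F and f to be continuous on the whole line
   avoids one-sided notions; any function continuous on [0, l] is composed with
   the retraction clamp below to get such an extension. *)
Definition C1_on l F f := [/\ continuous F, continuous f &
  forall x, 0 < x < l -> is_derive x 1 F (f x)].

Definition clamp l (x : R) := Num.max 0 (Num.min x l).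

Lemma continuous_clamp l : continuous (clamp l).
Proof.
move=> x; apply: (@continuous_max _ _ (cst 0) (fun x => Num.min x l)).
  exact: cst_continuous.
apply: (@continuous_min _ _ id (cst l)); last exact: cst_continuous.
exact: cvg_id.
Qed.

Lemma clamp_id l x : 0 <= x <= l -> clamp l x = x.
Proof.
by move=> /andP[x0 xl]; rewrite /clamp min_l// max_r.
Qed.

Lemma clamp_itv l x : 0 < l -> 0 <= clamp l x <= l.
Proof.
move=> l0; rewrite /clamp le_max lexx /= ge_max ltW//= ge_min lexx orbT//.
Qed.

Lemma continuous_comp_clamp l f : 0 < l -> {within `[0, l], continuous f} ->
  continuous (f \o clamp l).
Proof.
move=> l0 /subspace_continuousP cf x; apply: cvg_comp (cf (clamp l x) _).
  move=> A nA; have nB : nbhs x (fun y => `[0, l]%classic (clamp l y) -> A (clamp l y)).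
    exact: (@continuous_clamp l x _ nA).
  suff : nbhs x (fun y => A (clamp l y)) by [].
  apply: filterS nB => y; apply; rewrite /= in_itv /=; exact: clamp_itv.
by rewrite /= in_itv /= clamp_itv.
Qed.

Lemma is_derive_eq_itv l F G f : (forall x, 0 < x < l -> F x = G x) ->
  (forall x, 0 < x < l -> is_derive x 1 F (f x)) ->
  (forall x, 0 < x < l -> is_derive x 1 G (f x)).
Proof.
move=> FG dF x xl; apply: near_eq_is_derive (dF x xl); near=> y; apply: FG; near: y.
have := @near_in_itvoo R 0 l x; rewrite in_itv /= => /(_ xl).
by apply: filterS => y; rewrite in_itv.
Unshelve. all: by end_near. Qed.

Lemma C1_on_mul l F f G g : C1_on l F f -> C1_on l G g ->
  C1_on l (fun x => F x * G x) (fun x => f x * G x + F x * g x).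
Proof.
move=> [cF cf dF] [cG cg dG]; split.
- by move=> x; exact: continuousM (cF x) (cG x).
- move=> x; exact: continuousD (continuousM (cf x) (cG x))
    (continuousM (cF x) (cg x)).
- move=> x xl; have dFx := dF x xl; have dGx := dG x xl.
  apply: is_derive_eq.
  by rewrite /GRing.scale/= addrC; congr (_ + _); rewrite mulrC.
Qed.

Lemma C1_on_add l F f G g : C1_on l F f -> C1_on l G g ->
  C1_on l (fun x => F x + G x) (fun x => f x + g x).
Proof.
move=> [cF cf dF] [cG cg dG]; split.
- by move=> x; exact: continuousD (cF x) (cG x).
- by move=> x; exact: continuousD (cf x) (cg x).
- by move=> x xl; have dFx := dF x xl; have dGx := dG x xl; apply: is_derive_eq.
Qed.

Lemma C1_on_scale l c F f : C1_on l F f ->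
  C1_on l (fun x => c * F x) (fun x => c * f x).
Proof.
move=> [cF cf dF]; split.
- by move=> x; apply: continuousM (cF x); exact: cst_continuous.
- by move=> x; apply: continuousM (cf x); exact: cst_continuous.
- by move=> x xl; have dFx := dF x xl; apply: is_derive_eq.
Qed.

Lemma C1_on_sub l F f G g : C1_on l F f -> C1_on l G g ->
  C1_on l (fun x => F x - G x) (fun x => f x - g x).
Proof.
move=> [cF cf dF] [cG cg dG]; split.
- by move=> x; exact: continuousB (cF x) (cG x).
- by move=> x; exact: continuousB (cf x) (cg x).
- by move=> x xl; have dFx := dF x xl; have dGx := dG x xl; apply: is_derive_eq.
Qed.

Lemma integral_C1 l F f : 0 < l -> C1_on l F f ->
  \int[leb]_(x in `]0, l[) f x = F l - F 0.
Proof. by move=> l0 [cF cf dF]; exact: FTC2. Qed.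


(** [in_Lp] tolerates an exceptional null set; [sqi] is the strict version, for representatives that
    are themselves measurable on [D]. *)
Definition sqi (D : set (measurableTypeR R)) (f : R -> R) :=
  measurable_fun D (f : _ -> measurableTypeR R) /\ intg D (fun x => f x ^+ 2).

Lemma intg_mul_sqi (D : set (measurableTypeR R)) f g : measurable D ->
  sqi D f -> sqi D g -> intg D (fun x => f x * g x).
Proof.
move=> mD [mf fi] [mg gi]; apply: (@le_intg D _ (fun x => f x ^+ 2 + g x ^+ 2)).
- by [].
- exact: measurable_funM.
- move=> x _; rewrite normrM.
  rewrite -(real_normK (num_real (f x))) -(real_normK (num_real (g x))).
  have := sqr_ge0 (`|f x| - `|g x|).
  have := normr_ge0 (f x); have := normr_ge0 (g x); nra.
- exact: intgD.
Qed.

Lemma sqi_intg a b f : sqi `]a, b[ f -> intg `]a, b[ f.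
Proof.
move=> [mf fi]; apply: (@le_intg _ _ (fun x => 1 + f x ^+ 2)) => //.
- move=> x _; rewrite -(real_normK (num_real (f x))).
  by have := sqr_ge0 (`|f x| - 1); have := normr_ge0 (f x); nra.
- by apply: intgD => //; apply: intg_continuous => x; exact: cst_continuous.
Qed.

Lemma sqiD (D : set (measurableTypeR R)) f g : measurable D ->
  sqi D f -> sqi D g -> sqi D (fun x => f x + g x).
Proof.
move=> mD sf sg; have fg := intg_mul_sqi mD sf sg.
case: sf => mf fi; case: sg => mg gi; split; first exact: measurable_funD.
have := intgD mD (intgD mD fi (intgZ 2 mD fg)) gi.
by apply: eq_intg => // x _; ring.
Qed.

Lemma sqiZ (D : set (measurableTypeR R)) c f : measurable D ->
  sqi D f -> sqi D (fun x => c * f x).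
Proof.
move=> mD [mf fi]; split; first by apply: measurable_funM.
by have := intgZ (c ^+ 2) mD fi; apply: eq_intg => // x _; ring.
Qed.

Lemma sqiB (D : set (measurableTypeR R)) f g : measurable D ->
  sqi D f -> sqi D g -> sqi D (fun x => f x - g x).
Proof.
move=> mD sf sg; have [mN iN] := sqiD mD sf (sqiZ (- 1) mD sg).
split.
  by apply: eq_measurable_fun mN => x _; rewrite mulN1r.
by apply: eq_intg iN => // x _; rewrite mulN1r.
Qed.

Lemma continuous_sqr f : continuous f -> continuous (fun x => f x ^+ 2).
Proof.
by move=> cf x; exact: continuousM (cf x) (cf x).
Qed.

Lemma continuous_sqi a b f : continuous f -> sqi `]a, b[ f.
Proof.
move=> cf; split; first exact: continuous_measurable_on.
by apply: intg_continuous; exact: continuous_sqr.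
Qed.

(** A plain integral of squares, to which both [sobolev_norm] and [Lp_norm] at exponent 2 are
    reduced later. *)
Definition nrm l f := Num.sqrt (\int[leb]_(x in `]0, l[) (f x ^+ 2)).

Lemma nrm_ge0 l f : 0 <= nrm l f. Proof. exact: sqrtr_ge0. Qed.

Lemma nrm_sqr l f : nrm l f ^+ 2 = \int[leb]_(x in `]0, l[) (f x ^+ 2).
Proof. by rewrite sqr_sqrtr// Rintegral_ge0// => x _; exact: sqr_ge0. Qed.

Lemma cauchy_schwarz l f g : sqi `]0, l[ f -> sqi `]0, l[ g ->
  `|\int[leb]_(x in `]0, l[) (f x * g x)| <= nrm l f * nrm l g.
Proof.
move=> sf sg.
have mD : measurable (`]0, l[%classic : set (measurableTypeR R)) by [].
have fg := intg_mul_sqi mD sf sg.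
case: sf => mf fi; case: sg => mg gi.
rewrite -ler_sqr ?nnegrE ?mulr_ge0 ?nrm_ge0// exprMn !nrm_sqr.
set A := (X in X * _); set B := (X in _ * X); set C := \int[leb]_(x in _) _.
(* The discriminant argument: the square of f - t g has a nonnegative integral for every [t]. *)
have H t : 0 <= A - 2 * t * C + t ^+ 2 * B.
  have : 0 <= \int[leb]_(x in `]0, l[) ((f x - t * g x) ^+ 2).
    by apply: Rintegral_ge0 => x _; exact: sqr_ge0.
  have -> : \int[leb]_(x in `]0, l[) ((f x - t * g x) ^+ 2) =
    \int[leb]_(x in `]0, l[) (f x ^+ 2 - 2 * t * (f x * g x) + t ^+ 2 * g x ^+ 2).
    by apply: eq_Rintegral => x _; ring.
  rewrite RintegralD//; last 2 first.
    by apply: intgB => //; exact: intgZ.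
    exact: intgZ.
  rewrite RintegralB//; last exact: intgZ.
  by rewrite RintegralZl// RintegralZl//.
rewrite real_normK ?num_real//.
have B0 : 0 <= B by apply: Rintegral_ge0 => x _; exact: sqr_ge0.
have [B_eq0|B_neq0] := eqVneq B 0.
  have [->|C0] := eqVneq C 0; first by rewrite expr0n /= B_eq0 mulr0.
  (* For B = 0 the quadratic is affine in [t]; this choice of [t] gives it the value -1. *)
  have := H ((A + 1) / (2 * C)); rewrite B_eq0 mulr0 addr0.
  rewrite (_ : 2 * _ * C = A + 1); first by lra.
  by field.
have Bp : 0 < B by rewrite lt_def B_neq0.
have := H (C / B).
rewrite (_ : _ + _ = (A * B - C ^+ 2) / B); last by field.
by rewrite pmulr_lge0 ?invr_gt0// subr_ge0.
Qed.

(** Because c l < pi, the angle [th] stays strictly inside ]-pi/2, pi/2[ on the closed interval. For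
    c = pi / l the tangent in [p] would blow up at both ends, so the sharp constant is reached only
    as a limit. *)
Lemma wirtinger_aux l c w w' : 0 < l -> 0 < c -> c * l < pi ->
  C1_on l w w' -> w 0 = 0 -> w l = 0 -> c * nrm l w <= nrm l w'.
Proof.
move=> l0 c0 cl Cw w0 wl.
pose th x : R := c * (x - l / 2).
(* p solves the Riccati equation p' = - (c^2 + p^2) on [0, l], so that
   (w' - p w)^2 integrates to |w'|^2 - c^2 |w|^2. *)
pose p x := - c * (sin (th x) / cos (th x)).
pose P := p \o clamp l.
have cosp x : 0 <= x <= l -> 0 < cos (th x).
  move=> /andP[x0 xl]; apply: cos_gt0_pihalf; rewrite /th.
  by apply/andP; split; nra.
have dp x : 0 <= x <= l -> is_derive x 1 p (- (c ^+ 2 + p x ^+ 2)).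
  move=> xl; have cx := cosp x xl.
  have cx0 : cos (th x) != 0 by rewrite gt_eqF.
  have dth : is_derive x (1 : R) th c.
    by apply: is_derive_eq; rewrite /GRing.scale /=; ring.
  apply: is_derive_eq.
  by rewrite /GRing.scale /= /p; field.
have CP : C1_on l P (fun x => - (c ^+ 2 + P x ^+ 2)).
  have cP : continuous P.
    apply: continuous_comp_clamp => //; apply: continuous_in_subspaceT => x.
    rewrite inE /= in_itv /= => /dp [dx _].
    exact/differentiable_continuous/derivable1_diffP.
  split; first exact: cP.
  - move=> x; apply: (@continuousN _ _ _ (fun x => c ^+ 2 + P x ^+ 2)).
    apply: (@continuousD _ _ _ (cst (c ^+ 2)) (fun x => P x ^+ 2)).
      exact: cst_continuous.
    exact: continuous_sqr.
  - have PE x : 0 < x < l -> p x = P x.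
      by move=> /andP[x0 xl]; rewrite /P /= clamp_id// !ltW.
    apply: (is_derive_eq_itv PE) => x /[dup] xl /andP[x0 x1].
    rewrite -(PE _ xl); apply: dp.
    by rewrite !ltW.
have [cw cw' _] := Cw.
have [cP _ _] := CP.
have Cw2 := C1_on_mul CP (C1_on_mul Cw Cw).
have := integral_C1 l0 Cw2; rewrite /= w0 wl !mulr0 subr0 => I0.
rewrite -ler_sqr ?nnegrE ?mulr_ge0 ?nrm_ge0 ?(ltW c0)// exprMn !nrm_sqr.
rewrite -subr_ge0 -RintegralZl//; last by case: (continuous_sqi 0 l cw).
rewrite -RintegralB//; last 2 first.
- by case: (continuous_sqi 0 l cw').
- by apply: intgZ => //; case: (continuous_sqi 0 l cw).
have E (y z : R) : z = 0 -> y = y - z by move=> ->; rewrite subr0.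
rewrite [leRHS](E _ _ I0) -RintegralB//.
- by apply: Rintegral_ge0 => x _; rewrite (_ : _ - _ = (w' x - P x * w x) ^+ 2);
    [exact: sqr_ge0|ring].
- apply: intgB => //; first by case: (continuous_sqi 0 l cw').
  by apply: intgZ => //; case: (continuous_sqi 0 l cw).
- by apply: intg_continuous; case: Cw2.
Qed.

Lemma wirtinger l w w' : 0 < l ->
  C1_on l w w' -> w 0 = 0 -> w l = 0 -> nrm l w <= l / pi * nrm l w'.
Proof.
move=> l0 Cw w0 wl; have pi0 : 0 < pi :> R by exact: pi_gt0.
suff : pi / l * nrm l w <= nrm l w'.
  rewrite mulrAC ler_pdivrMr// => H.
  by rewrite mulrAC ler_pdivlMr// mulrC [leRHS]mulrC.
apply/ler_addgt0Pr => e e0.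
have [n0|n0] := eqVneq (nrm l w) 0.
  by rewrite n0 mulr0 addr_ge0 ?nrm_ge0 ?ltW.
have np : 0 < nrm l w by rewrite lt_def n0 nrm_ge0.
(* The first argument loses at most [e] after multiplication by [nrm l w]; the second only keeps [c]
   positive when [e] is large. *)
pose c := Num.max (pi / l - e / nrm l w) (pi / l / 2).
have pl : 0 < pi / l by exact: divr_gt0.
have c0 : 0 < c by rewrite lt_max divr_gt0 ?orbT.
have cl : c * l < pi.
  rewrite -ltr_pdivlMr// gt_max ltrBlDr ltrDl divr_gt0//=.
  by rewrite ltr_pdivrMr// ltr_pMr// ltr1n.
have := wirtinger_aux l0 c0 cl Cw w0 wl.
rewrite -lerBlDr; apply: le_trans.
rewrite (_ : _ - e = (pi / l - e / nrm l w) * nrm l w); last first.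
  by rewrite mulrBl divfK.
by rewrite ler_wpM2r ?nrm_ge0// le_max lexx.
Qed.

End Basics.

(** * Smooth functions and test functions *)

Section Smooth.
Context {R : realType}.
Implicit Types (f g phi psi : R -> R) (x : R).

Definition smooth f := forall n x, derivable (derive1n n f) x 1.

Lemma derive1_is_derive f g : (forall x, is_derive x 1 f (g x)) -> (derive1 f) = g.
Proof. by move=> fg; apply/funext => x; rewrite derive1E; case: (fg x). Qed.

(** Coinduction for smoothness: a family closed under differentiation consists of smooth functions,
    which avoids any formula for higher derivatives. *)
Lemma smooth_coind (P : (R -> R) -> Prop) :
  (forall f, P f -> exists2 g, P g & forall x, is_derive x 1 f (g x)) ->
  forall f, P f -> smooth f.
Proof.
move=> Pd f Pf n; elim: n f Pf => [|n IH] f Pf x.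
  by rewrite derive1n0; have [g _ /(_ x) []] := Pd f Pf.
rewrite derive1Sn; apply: IH.
by have [g Pg /derive1_is_derive ->] := Pd f Pf.
Qed.

Lemma smooth_is_derive f x : smooth f -> is_derive x 1 f ((derive1 f) x).
Proof. by move=> /(_ 0%N x) df; rewrite derive1E; exact: derivableP. Qed.

Lemma smooth_derive f : smooth f -> smooth (derive1 f).
Proof. by move=> sf n x; rewrite -derive1Sn; exact: sf. Qed.

Lemma smooth_continuous f : smooth f -> continuous f.
Proof.
move=> sf x; apply: differentiable_continuous; apply/derivable1_diffP.
exact: (sf 0%N x).
Qed.

Lemma smooth_comp_affine f (c d : R) : smooth f ->
  smooth (fun x => f (c * x + d)).
Proof.
move=> sf; apply: (@smooth_coind (fun h => exists (k : R) g, smooth g /\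
    h = (fun x => k * g (c * x + d)))); last first.
  by exists 1, f; split; [exact: sf|]; apply/funext => x; rewrite mul1r.
move=> _ [k [g [sg ->]]]; exists (fun x => (k * c) * (derive1 g) (c * x + d)).
  by exists (k * c), (derive1 g); split; [exact: smooth_derive|].
move=> x; have da : is_derive x (1 : R) (fun x => c * x + d) c.
  by apply: is_derive_eq; rewrite /GRing.scale /= mulr1 addr0.
have dg := @is_derive1_comp _ g _ _ _ _ (smooth_is_derive _ sg) da.
by apply: is_derive_eq; rewrite /GRing.scale /=; ring.
Qed.

Lemma smoothZ f c : smooth f -> smooth (fun x => c * f x).
Proof.
move=> sf; apply: (@smooth_coind (fun h => exists g, smooth g /\
    h = (fun x => c * g x))); last by exists f.
move=> _ [g [sg ->]]; exists (fun x => c * (derive1 g) x).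
  by exists (derive1 g); split; [exact: smooth_derive|].
move=> x; have dg := smooth_is_derive x sg.
by apply: is_derive_eq.
Qed.

Lemma smoothB f g : smooth f -> smooth g -> smooth (fun x => f x - g x).
Proof.
move=> sf sg; apply: (@smooth_coind (fun h => exists u v, [/\ smooth u, smooth v &
    h = (fun x => u x - v x)])); last by exists f, g.
move=> _ [u [v [su sv ->]]]; exists (fun x => (derive1 u) x - (derive1 v) x).
  by exists (derive1 u), (derive1 v); split; [exact: smooth_derive..|].
move=> x; have du := smooth_is_derive x su; have dv := smooth_is_derive x sv.
by apply: is_derive_eq.
Qed.

Lemma smoothM f g : smooth f -> smooth g -> smooth (fun x => f x * g x).
Proof.
move=> sf sg.
(* A product alone is not stable under differentiation, but finite sums of products are: by the
   Leibniz rule each pair of the list is replaced by two pairs. *)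
pose sumM (s : seq ((R -> R) * (R -> R))) x := \sum_(p <- s) p.1 x * p.2 x.
apply: (@smooth_coind (fun h => exists s,
   (forall p, List.In p s -> smooth p.1 /\ smooth p.2) /\ h = sumM s));
  last first.
  exists [:: (f, g)]; split; first by move=> p [<-|[]].
  by apply/funext => x; rewrite /sumM big_seq1.
move=> _ [s [Hs ->]].
pose t := flatten [seq [:: ((derive1 p.1), p.2); (p.1, (derive1 p.2))] | p <- s].
exists (sumM t).
  exists t; split; [move=> p; rewrite /t|by []].
  elim: s Hs {t} => [_ []|q s IH Hs /=] [<-|[<-|/IH]].
  - have [s1 s2] : smooth q.1 /\ smooth q.2 by apply: Hs; left.
    by split; [exact: smooth_derive|exact: s2].
  - have [s1 s2] : smooth q.1 /\ smooth q.2 by apply: Hs; left.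
    by split; [exact: s1|exact: smooth_derive].
  - by apply => r rs; apply: Hs; right.
move=> x; rewrite {}/t; elim: s Hs => [|q s IH] Hs /=.
  rewrite (_ : sumM [::] = cst 0); last first.
    by apply/funext => y; rewrite /sumM big_nil.
  exact: is_derive_cst.
have {}IH := IH (fun p ps => Hs p (or_intror ps)).
have [s1 s2] : smooth q.1 /\ smooth q.2 by apply: Hs; left.
rewrite (_ : sumM (q :: s) = (fun y => q.1 y * q.2 y + sumM s y)); last first.
  by apply/funext => y; rewrite /sumM big_cons.
have d1 := smooth_is_derive x s1; have d2 := smooth_is_derive x s2.
apply: is_derive_eq.
rewrite /sumM !big_cons /= addrA; congr (_ + _).
by rewrite /GRing.scale/= addrC; congr (_ + _); exact: mulrC.
Qed.

(* This family is stable under differentiation, hence consists of smooth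
   functions. *)
Definition flat (p : {poly R}) (t : R) : R :=
  if t <= 0 then 0 else p.[t^-1] * expR (- t^-1).

(** Each monomial satisfies s^i exp(-s) <= i!, as s^i / i! is a term of the exponential series; the
    constant adds these bounds up. *)
Lemma poly_expR_bounded (p : {poly R}) :
  exists2 C : R, 0 <= C & forall s, 0 < s -> `|p.[s] * expR (- s)| <= C.
Proof.
exists (\sum_(i < size p) `|p`_i| * i`!%:R).
  by apply: sumr_ge0 => i _; rewrite mulr_ge0.
move=> s s0; rewrite horner_coef mulr_suml (le_trans (ler_norm_sum _ _ _))//.
apply: ler_sum => i _; rewrite -mulrA normrM ler_wpM2l//.
rewrite ger0_norm; last by rewrite mulr_ge0 ?exprn_ge0 ?expR_ge0// ltW.
rewrite expRN ler_pdivrMr ?expR_gt0//.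
case: i => [[|i] _] /=.
  by rewrite expr0 fact0 mul1r -expR0 ler_expR ltW.
have := expR_ge1Dxn i (ltW s0).
have f0 : 0 < (i.+1)`!%:R :> R by rewrite ltr0n fact_gt0.
rewrite -(ler_pM2l f0) mulrDr mulrCA divff ?gt_eqF// !mulr1.
by apply: le_trans; rewrite lerDr ltW.
Qed.

(** For t > 0 the chain rule turns both factors into functions of 1/t and brings out t^-2, whence
    the polynomial (p - p') X^2. The point 0 is treated by the difference quotient. *)
Lemma flat_is_derive (p : {poly R}) x :
  is_derive x 1 (flat p) (flat ((p - p^`()) * 'X^2) x).
Proof.
have [x0|x0|x0] := ltgtP x 0.
- rewrite {2}/flat ltW//.
  apply: near_eq_is_derive (is_derive_cst (0 : R) x 1).
  near=> y; rewrite /flat ifT//; near: y.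
  by apply: filterS (lt_nbhsl x0) => y /ltW.
- rewrite {2}/flat leNgt x0 /=.
  have x_neq0 : x != 0 by rewrite gt_eqF.
  have dV : is_derive x (1 : R) (fun t => t^-1) (- x ^- 2).
    split; first exact: (@derivableV _ _ id).
    by rewrite (@deriveV _ _ id)// derive_id /GRing.scale /= mulr1.
  have dVN : is_derive x (1 : R) (fun t => - t^-1) (x ^- 2).
    have := is_deriveN dV; rewrite opprK; exact.
  have dp := is_derive1_comp (is_derive_poly p x^-1) dV.
  have de := @is_derive1_comp _ _ (fun t => - t^-1) _ _ _ (is_derive_expR _) dVN.
  have dM : is_derive x (1 : R) (fun t => p.[t^-1] * expR (- t^-1))
      (((p - p^`()) * 'X^2).[x^-1] * expR (- x^-1)).
    apply: is_derive_eq.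
    rewrite /GRing.scale /= hornerM hornerD hornerN hornerXn exprVn.
    ring.
  apply: near_eq_is_derive dM.
  near=> y; rewrite /flat ifF//; near: y.
  by apply: filterS (lt_nbhsr x0) => y y0; apply/negbTE; rewrite -ltNge.
- rewrite {2}/flat x0 lexx.
  (* The difference quotient at 0 is h times the value at 1/h of p(s) s^2 exp(-s), hence at most C
     h; this is why the bound is taken for p X^2. *)
  have [C C0 HC] := poly_expR_bounded (p * 'X^2).
  have H : (fun h => h^-1 *: (flat p (h *: 1 + 0) - flat p 0)) @ 0^' --> (0 : R).
    apply/cvgrPdist_le => e e0; near=> h.
    have h0 : h != 0 by near: h; exact: nbhs_dnbhs_neq.
    rewrite sub0r normrN addr0 [h *: 1]mulr1 {2}/flat lexx subr0.
    rewrite /flat; case: (leP h 0) => hp; first by rewrite scaler0 normr0 ltW.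
    have hi : 0 < h^-1 by rewrite invr_gt0.
    have := HC h^-1 hi.
    rewrite hornerM hornerXn.
    rewrite (_ : _ * _ * _ = h^-1 * (h^-1 * (p.[h^-1] * expR (- h^-1)))); last by ring.
    rewrite normrM gtr0_norm ?invr_gt0// ler_pdivrMl// => /le_trans; apply.
    have hC : h < e / (C + 1).
      apply: le_lt_trans (ler_norm h) _; near: h; apply: dnbhs0_lt.
      by rewrite divr_gt0// ltr_wpDl.
    rewrite ltr_pdivlMr ?ltr_wpDl// in hC.
    by apply: (le_trans _ (ltW hC)); rewrite ler_pM2l// lerDl.
  split; first by apply/cvg_ex; exists 0.
  exact/cvg_lim.
Unshelve. all: by end_near. Qed.

Lemma smooth_flat (p : {poly R}) : smooth (flat p).
Proof.
apply: (@smooth_coind (fun h => exists q, h = flat q)); last by exists p.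
move=> _ [q ->]; exists (flat ((q - q^`()) * 'X^2)); first by eexists.
exact: flat_is_derive.
Qed.


(** * Test functions: supports, stability, bumps *)

Lemma test_function_support (l : R) phi : test_function l phi ->
  exists a b, [/\ 0 < a, b < l & forall x, ~~ (a <= x <= b) -> phi x = 0].
Proof.
move=> [_ csupp sub]; set S := closure _ in csupp sub.
have [S0|/set0P S0] := eqVneq S set0.
  (* Here [phi] vanishes identically, and any margins will do; the order of the two numbers is not
     prescribed. *)
  exists 1, (l - 1); split => //; first by rewrite ltrBlDr ltrDl.
  move=> x _; apply: contrapT => /eqP px.
  suff : S x by rewrite S0.
  exact: subset_closure.
have cid : {within S, continuous (id : R -> R)}.
  by apply: continuous_subspaceT => x; exact: cvg_id.
have [a /set_mem Sa Ha] := compact_EVT_min S0 csupp cid.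
have [b /set_mem Sb Hb] := compact_EVT_max S0 csupp cid.
exists a, b; split.
- by have := sub _ Sa; rewrite /= in_itv /= => /andP[].
- by have := sub _ Sb; rewrite /= in_itv /= => /andP[].
move=> x; apply: contraNeq => px.
have Sx : x \in S by rewrite inE; exact: subset_closure.
by rewrite Ha// Hb.
Qed.

Lemma test_functionP (l : R) phi : smooth phi ->
  (exists a b, [/\ 0 < a, b < l & forall x, ~~ (a <= x <= b) -> phi x = 0]) ->
  test_function l phi.
Proof.
move=> sphi [a [b [a0 bl Hab]]].
have sub : closure [set x | phi x != 0] `<=` `[a, b].
  rewrite [X in _ `<=` X](_ : _ = closure `[a, b]); last first.
    by apply/closure_id; exact: itv_closed.
  apply: closure_subset => x /=; rewrite in_itv /=.
  by apply: contraNT => /Hab ->.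
split; first exact: sphi.
- apply: (subclosed_compact _ (@segment_compact _ a b)) => //.
  exact: closed_closure.
- move=> x /sub /=; rewrite !in_itv /= => /andP[ax xb].
  by rewrite (lt_le_trans a0 ax) (le_lt_trans xb bl).
Qed.

Lemma test_function_smooth (l : R) phi : test_function l phi -> smooth phi.
Proof. by case. Qed.

Lemma test_function_bounds (l : R) phi : test_function l phi ->
  phi 0 = 0 /\ phi l = 0.
Proof.
move=> /test_function_support [a [b [a0 bl H]]]; split; apply: H.
- by rewrite leNgt a0.
- by rewrite [l <= b]leNgt bl andbF.
Qed.

Lemma test_function_derive (l : R) phi : test_function l phi ->
  test_function l (derive1 phi).
Proof.
move=> tphi; have [a [b [a0 bl H]]] := test_function_support tphi.
apply: test_functionP; first exact: smooth_derive (test_function_smooth tphi).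
exists a, b; split => // x xab; rewrite derive1E.
rewrite (@near_eq_derive _ _ _ phi (cst 0)) ?derive_cst//.
move: xab; rewrite negb_and -!ltNge => /orP[xa|bx].
- apply: filterS (lt_nbhsl xa) => y ya; apply: H.
  by rewrite [a <= y]leNgt ya.
- apply: filterS (lt_nbhsr bx) => y yb; apply: H.
  by rewrite [y <= b]leNgt yb andbF.
Qed.

Lemma test_function_subZ (l c : R) phi psi : test_function l phi ->
  test_function l psi -> test_function l (fun x => phi x - c * psi x).
Proof.
move=> tp tq; have [a [b [a0 bl H]]] := test_function_support tp.
have [a' [b' [a0' bl' H']]] := test_function_support tq.
apply: test_functionP.
  apply: smoothB; first exact: test_function_smooth tp.
  exact: smoothZ (test_function_smooth tq).
exists (Num.min a a'), (Num.max b b'); split.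
- by rewrite lt_min a0.
- by rewrite gt_max bl.
- move=> x; rewrite ge_min le_max => xab; rewrite H ?H' ?mulr0 ?subr0//.
  + by apply: contra xab => /andP[-> ->]; rewrite !orbT.
  + by apply: contra xab => /andP[-> ->].
Qed.

Lemma test_function_C1 (l : R) phi : test_function l phi ->
  C1_on l phi (derive1 phi).
Proof.
move=> tp; have sp := test_function_smooth tp; split.
- exact: smooth_continuous.
- exact/smooth_continuous/smooth_derive.
- by move=> x _; exact: smooth_is_derive.
Qed.

(* Tends to the indicator of ]a, b[, since exp(- 1 / (n t)) tends to 1 for t > 0. *)
Definition bump_fun (a b : R) (n : nat) x : R :=
  flat 1 (n.+1%:R * (x - a)) * flat 1 (n.+1%:R * (b - x)).

Lemma test_function_bump (l a b : R) n : 0 < a -> b < l ->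
  test_function l (bump_fun a b n).
Proof.
move=> a0 bl; apply: test_functionP.
  apply: smoothM.
  - rewrite (_ : (fun _ => _) =
      (fun x => flat 1 (n.+1%:R * x + (- (n.+1%:R * a)))));
      last by apply/funext => x; rewrite mulrBr.
    exact/smooth_comp_affine/smooth_flat.
  - rewrite (_ : (fun _ => _) =
      (fun x => flat 1 (- n.+1%:R * x + n.+1%:R * b)));
      last by apply/funext => x; rewrite mulrBr mulNr addrC.
    exact/smooth_comp_affine/smooth_flat.
exists a, b; split => // x; rewrite negb_and -!ltNge /bump_fun /flat => /orP[xa|bx].
- by rewrite [X in X * _]ifT ?mul0r// pmulr_rle0// subr_le0 ltW.
- by rewrite [X in _ * X]ifT ?mulr0// pmulr_rle0// subr_le0 ltW.
Qed.

Lemma flat1_le1 t : `|flat 1 t| <= 1.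
Proof.
rewrite /flat; case: ifPn => [_|]; first by rewrite normr0.
rewrite -ltNge => t0; rewrite hornerC mul1r ger0_norm ?expR_ge0//.
by rewrite -expR0 ler_expR oppr_le0 invr_ge0 ltW.
Qed.

Lemma flat1_cvg t : (fun n => flat 1 (n.+1%:R * t)) @ \oo -->
  (if t <= 0 then 0 else 1 : R).
Proof.
case: leP => t0.
  rewrite (_ : (fun _ => _) = cst 0); first exact: cvg_cst.
  by apply/funext => n; rewrite /flat ifT// pmulr_rle0.
rewrite (_ : (fun _ => _) = (fun n => expR (- (t^-1 * n.+1%:R^-1)))); last first.
  apply/funext => n; rewrite /flat ifF; last first.
    by apply/negbTE; rewrite -ltNge mulr_gt0.
  by rewrite hornerC mul1r invfM mulrC.
rewrite -[X in _ --> X]expR0.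
apply: continuous_cvg; first exact: continuous_expR.
rewrite -oppr0; apply: cvgN; rewrite -(mulr0 t^-1).
apply: cvgM; [exact: cvg_cst|exact: cvg_harmonic].
Qed.

Lemma bump_le1 a b n x : `|bump_fun a b n x| <= 1.
Proof.
by rewrite normrM -[leRHS]mulr1 ler_pM ?flat1_le1.
Qed.

Lemma bump_cvg a b x : (fun n => bump_fun a b n x) @ \oo -->
  (if a < x < b then 1 else 0 : R).
Proof.
have -> : (if a < x < b then 1 else 0 : R) =
    (if x - a <= 0 then 0 else 1) * (if b - x <= 0 then 0 else 1).
  rewrite !subr_le0 [x <= a]leNgt [b <= x]leNgt.
  by case: (a < x); case: (x < b); rewrite /= ?(mulr0,mul0r,mulr1).
by apply: cvgM; exact: flat1_cvg.
Qed.

End Smooth.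

(** * The lemma of du Bois-Reymond *)

Section Fundamental.
Context {R : realType}.
Local Notation leb := (@lebesgue_measure R).
Implicit Types (l a b : R) (f g phi psi V : R -> R).

Lemma Rintegral_dominated_cvg (D : set (measurableTypeR R)) (f_ : nat -> R -> R)
    f h : measurable D ->
  (forall n, measurable_fun D (f_ n : _ -> measurableTypeR R)) ->
  (forall x, D x -> f_ n x @[n --> \oo] --> f x) ->
  (forall n x, D x -> `|f_ n x| <= h x) -> intg D h ->
  (fun n => \int[leb]_(x in D) f_ n x) @ \oo --> \int[leb]_(x in D) f x.
Proof.
move=> mD mf cvf bf hi.
have mf' : measurable_fun D (f : _ -> measurableTypeR R).
  exact: (@measurable_fun_cvg _ _ _ _ f_).
have fi : intg D f.
  apply: (le_intg mD mf' _ hi) => x Dx.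
  have cN : (fun n => `|f_ n x|) @ \oo --> `|f x|.
    exact: cvg_norm (cvf x Dx).
  rewrite -(cvg_lim (@Rhausdorff R) cN).
  apply: limr_le; first by apply/cvg_ex; exists `|f x|.
  by apply: nearW => n; exact: bf.
apply: fine_cvg; rewrite fineK; last exact: integrable_fin_num.
apply: (@dominated_cvg _ _ _ leb D mD (fun n x => (f_ n x)%:E) (EFin \o f)
  (EFin \o h)) => //.
- by move=> n; have /measurable_EFinP := mf n.
- by move=> x Dx; apply: cvg_EFin; [exact: nearW|exact: cvf].
Qed.

(** The bumps converge boundedly to the indicator of ]a, b[, so dominated convergence, with
    dominating function |g|, carries the orthogonality to that indicator. *)
Lemma integral_interval_eq0 l g a b : intg `]0, l[ g ->
  (forall phi, test_function l phi ->
     \int[leb]_(x in `]0, l[) (g x * phi x) = 0) ->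
  0 < a -> b < l -> \int[leb]_(x in `]a, b[) g x = 0.
Proof.
move=> gi Hg a0 bl.
pose chi x : R := if a < x < b then 1 else 0.
have tbump n := test_function_bump n a0 bl.
have cbump n := smooth_continuous (test_function_smooth (tbump n)).
have mD : measurable (`]0, l[%classic : set (measurableTypeR R)) by [].
have := @Rintegral_dominated_cvg `]0, l[%classic
  (fun n x => g x * bump_fun a b n x) (fun x => g x * chi x)
  (fun x => `|g x|) mD.
have -> : (fun n => \int[leb]_(x in `]0, l[) (g x * bump_fun a b n x)) = cst 0.
  by apply/funext => n; exact: Hg (tbump n).
move=> H0; have {H0} H : cst 0 @ \oo --> \int[leb]_(x in `]0, l[) (g x * chi x).
  apply: H0.
  - move=> n; apply: measurable_funM; first exact: intg_measurable gi.
    exact: continuous_measurable_on.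
  - by move=> x _; apply: cvgM; [exact: cvg_cst|exact: bump_cvg].
  - by move=> n x _; rewrite normrM ler_piMr// bump_le1.
  - exact: intg_norm.
have {}H : 0 = \int[leb]_(x in `]0, l[) (g x * chi x).
  have c0 : (fun _ : nat => 0 : R) @ \oo --> (0 : R) by exact: cvg_cst.
  exact: (cvg_unique (@Rhausdorff R) c0 H).
rewrite [RHS]H [LHS]Rintegral_mkcond [RHS]Rintegral_mkcond.
apply: eq_Rintegral => x _; rewrite !patchE /chi.
have -> : (x \in `]a, b[%classic) = (a < x < b) by apply/idP/idP; rewrite inE /= in_itv.
have -> : (x \in `]0, l[%classic) = (0 < x < l) by apply/idP/idP; rewrite inE /= in_itv.
case: ifPn => [/andP[ax xb]|]; last by rewrite mulr0 if_same.
by rewrite (lt_trans a0 ax) (lt_trans xb bl) mulr1.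
Qed.

(* The integrals of g over intervals vanish, hence so does their derivative, which
   is almost everywhere g. *)
Lemma fundamental_lemma l g : intg `]0, l[ g ->
  (forall phi, test_function l phi ->
     \int[leb]_(x in `]0, l[) (g x * phi x) = 0) ->
  {ae leb, forall x : R, `]0, l[%classic x -> g x = 0}.
Proof.
move=> gi Hg.
have mD : measurable (`]0, l[%classic : set (measurableTypeR R)) by [].
pose h := g \_ `]0, l[.
have hi : leb.-integrable setT (EFin \o h).
  have := gi; rewrite /intg /h => /(integrable_mkcond _ mD).
  by rewrite -restrict_EFin.
have hli : locally_integrable setT h.
  split => //.
  - by have := measurable_int _ hi => /measurable_EFinP.
  - exact: openT.
  - move=> K _ cK; have /integrableP[mh] := hi.
    apply: le_lt_trans; apply: ge0_subset_integral => //.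
    + exact: compact_measurable.
    + by apply/measurable_EFinP; apply: measurableT_comp => //; exact/measurable_EFinP.
have hNy y : leb.-integrable `]-oo, y] (EFin \o h) by exact: integrableS hi.
have := FTC1Ny hNy hli; apply: filterS; first exact: (ae_filter_ringOfSetsType leb).
move=> x [dF F'] /= xl.
have gh : g x = h x by rewrite /h patchE mem_set.
rewrite gh -F' derive1E (@near_eq_derive _ _ _ _
  (cst (\int[leb]_(t in `]-oo, x]) h t))) ?derive_cst//.
move: xl; rewrite in_itv /= => /andP[x0 xl].
have I0 a b : 0 < a -> a <= b -> b < l ->
    \int[leb]_(t in `]-oo, b]) h t = \int[leb]_(t in `]-oo, a]) h t.
  move=> a0 ab bl; apply/eqP; rewrite -subr_eq0.
  rewrite (@Rintegral_itvB _ h -oo%O (BRight b) a)//.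
  rewrite -Rintegral_itv_bndo_bndc; last by exact: integrableS hi.
  rewrite -(integral_interval_eq0 gi Hg a0 bl); apply/eqP.
  apply: eq_Rintegral => t; rewrite inE /= in_itv /= => /andP[at_ tb].
  by rewrite /h patchE mem_set//= in_itv /= (lt_trans a0 at_) (lt_trans tb bl).
near=> y.
have y0 : 0 < y by near: y; exact: lt_nbhsr.
have yl : y < l by near: y; exact: lt_nbhsl.
by have [xy|/ltW yx] := leP x y; [|symmetry]; rewrite /=; apply: I0.
Unshelve. all: by end_near. Qed.

Lemma ae_eq0_continuous l f : 0 < l -> continuous f ->
  {ae leb, forall x : R, `]0, l[%classic x -> f x = 0} ->
  forall x, 0 <= x <= l -> f x = 0.
Proof.
move=> l0 cf [N [mN N0 sN]] x /andP[x0 xl]; apply: contrapT => fx.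
have /cvgrPdist_lt /(_ `|f x|) := cf x.
rewrite normr_gt0 => /(_ (introN eqP fx)) [e /= e0 He].
(* The trace on ]0, l[ of a ball around [x] where [f] stays nonzero; it has positive length even
   when [x] is an end point, which is why the conclusion reaches 0 and [l]. *)
pose a := Num.max 0 (x - e); pose b := Num.min l (x + e).
have ab : a < b.
  rewrite gt_max !lt_min l0 /=; apply/and3P; split; lra.
have sub : `]a, b[%classic `<=` N.
  move=> y /=; rewrite in_itv /= gt_max lt_min => /andP[/andP[y0 ye] /andP[yl ye']].
  apply: sN => /= H; have fy : f y = 0 by apply: H; rewrite in_itv /= y0.
  have := He y; rewrite fy subr0 ltxx => H'; suff : false by [].
  by apply: H'; rewrite /= ltr_norml; apply/andP; split; lra.
have : (leb `]a, b[%classic <= leb N)%E by apply: le_measure => //; rewrite inE.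
by rewrite N0 lebesgue_measure_itv /= lte_fin ab -EFinB lee_fin leNgt subr_gt0 ab.
Qed.


(** The primitive vanishes to the left of the support by construction and to the right of it because
    the mean is zero, so it is again compactly supported in ]0, l[. *)
Lemma test_function_primitive l psi : test_function l psi ->
  \int[leb]_(x in `]0, l[) psi x = 0 ->
  exists2 phi, test_function l phi & derive1 phi = psi.
Proof.
move=> tpsi I0; have [a [b [a0 bl H]]] := test_function_support tpsi.
have spsi := test_function_smooth tpsi; have cpsi := smooth_continuous spsi.
pose F (x : R) : R := \int[leb]_(t in `[-1, x]) psi t.
have F0 x : x < a -> F x = 0.
  move=> xa; rewrite /F (@eq_Rintegral _ _ _ _ _ (cst 0)).
    by rewrite Rintegral_cst// mul0r.
  move=> t; rewrite inE /= in_itv /= => /andP[_ tx]; apply: H.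
  by rewrite [a <= t]leNgt (le_lt_trans tx xa).
have F1 x : b < x -> F x = 0.
  move=> bx; rewrite /F -[RHS]I0 [LHS]Rintegral_mkcond [RHS]Rintegral_mkcond.
  congr Rintegral; apply/funext => t; rewrite !patchE.
  have [tab|/H ->] := boolP (a <= t <= b); last by rewrite !if_same.
  case/andP: tab => at_ tb; rewrite !mem_set//= in_itv /=.
  + by rewrite (lt_le_trans a0 at_) (le_lt_trans tb bl).
  + by rewrite (le_trans tb (ltW bx)) andbT (le_trans _ at_)// (le_trans _ (ltW a0)).
have dF (x : R) : is_derive x 1 F (psi x).
  have [xa|ax] := ltP x a.
    rewrite H; last by rewrite [a <= x]leNgt xa.
    apply: near_eq_is_derive (is_derive_cst (0 : R) x 1).
    by apply: filterS (lt_nbhsl xa) => y /F0.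
  have x1 : -1 < x by rewrite (lt_le_trans _ ax)// (lt_trans _ a0).
  have ipsi : leb.-integrable `[-1, x + 1] (EFin \o psi).
    apply: continuous_compact_integrable; first exact: segment_compact.
    exact: continuous_subspaceT.
  have xx1 : x < x + 1 by rewrite ltrDl.
  have [d1 d2] := continuous_FTC1_closed xx1 ipsi x1 (cpsi x).
  by split; [exact: d1|rewrite -d2 derive1E].
exists F; last exact: derive1_is_derive.
apply: test_functionP.
  apply: (@smooth_coind _ (fun h => smooth h \/ h = F)); last by right.
  move=> h [sh|->]; last by exists psi; [left|].
  by exists (derive1 h); [left; exact: smooth_derive|
    move=> x; exact: smooth_is_derive].
exists a, b; split => // x; rewrite negb_and -!ltNge => /orP[/F0|/F1] //.
Qed.

Lemma test_integral_parts l phi W w : 0 < l -> test_function l phi ->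
  C1_on l W w ->
  \int[leb]_(x in `]0, l[) (W x * derive1 phi x) =
  - \int[leb]_(x in `]0, l[) (w x * phi x).
Proof.
move=> l0 tphi CW; have Cphi := test_function_C1 tphi.
have [p0 pl] := test_function_bounds tphi.
have := integral_C1 l0 (C1_on_mul CW Cphi); rewrite /= p0 pl !mulr0 subr0.
case: CW => cW cw _; case: Cphi => cp cp' _.
rewrite RintegralD//; last 2 first.
- by apply: intg_mul_continuous => //; exact: intg_continuous.
- by apply: intg_mul_continuous => //; exact: intg_continuous.
by move=> /eqP; rewrite addrC addr_eq0 => /eqP.
Qed.

Lemma C1_on_affine l (c d : R) : C1_on l (fun x => c * x + d) (cst c).
Proof.
split.
- move=> x; apply: (@continuousD _ _ _ (fun x => c * x) (cst d)).
    by apply: (@continuousM _ _ (cst c) id); [exact: cst_continuous|exact: cvg_id].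
  exact: cst_continuous.
- by move=> x; exact: cst_continuous.
- move=> x _; apply: is_derive_eq; rewrite /GRing.scale /= mulr1 addr0 //.
Qed.

(* Fixing a test function eta of integral 1, subtracting a multiple of eta from a
   test function gives one with a test function as primitive; doing so twice
   writes every psi, up to eta and eta', as a second derivative phi''. *)
Lemma du_bois_reymond2 l V : 0 < l -> continuous V -> V 0 = 0 -> V l = 0 ->
  (forall phi, test_function l phi ->
     \int[leb]_(x in `]0, l[) (V x * derive1 (derive1 phi) x) = 0) ->
  forall x, 0 <= x <= l -> V x = 0.
Proof.
move=> l0 cV V0 Vl HV.
have mD : measurable (`]0, l[%classic : set (measurableTypeR R)) by [].
have tI phi : test_function l phi -> intg `]0, l[ phi.
  by move=> /test_function_smooth/smooth_continuous; exact: intg_continuous.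
have tWI (W : R -> R) phi : continuous W -> test_function l phi ->
    intg `]0, l[ (fun x => W x * phi x).
  by move=> cW /tI; exact: intg_mul_continuous.
have [eta teta Ieta] : exists2 eta, test_function l eta &
    \int[leb]_(x in `]0, l[) eta x = 1.
  (* If every test function had integral zero, the fundamental lemma would make the constant 1
     vanish. *)
  have [eta [teta Ieta]] : exists eta, test_function l eta /\
      \int[leb]_(x in `]0, l[) eta x <> 0.
    apply: contrapT => /forallNP no.
    have one : {ae leb, forall x : R, `]0, l[%classic x -> (1 : R) = 0}.
      apply: (@fundamental_lemma l (cst 1)).
        by apply: intg_continuous; exact: cst_continuous.
      move=> phi tphi; have /not_andP[//|/contrapT I0] := no phi.
      by rewrite -[RHS]I0; apply: eq_Rintegral => x _; rewrite mul1r.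
    have := @ae_eq0_continuous l (cst 1) l0 (@cst_continuous _ _ _) one 0.
    by rewrite lexx ltW// => /(_ isT) /eqP; rewrite oner_eq0.
  pose c := \int[leb]_(x in `]0, l[) eta x.
  (* This is eta / c, written in the shape covered by [test_function_subZ]. *)
  exists (fun x => eta x - (1 - c^-1) * eta x); first exact: test_function_subZ.
  rewrite RintegralB//; [|exact: tI|by apply: intgZ => //; exact: tI].
  rewrite RintegralZl//; last exact: tI.
  by rewrite -/c; field; apply/eqP.
(* The coefficients of the affine function with which [V] will be identified. The identity is
   spelled [1 * x + 0] to match [C1_on_affine]. *)
pose be := \int[leb]_(x in `]0, l[) (V x * derive1 eta x).
pose ve := \int[leb]_(x in `]0, l[) (V x * eta x).
pose xe := \int[leb]_(x in `]0, l[) ((1 * x + 0) * eta x).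
have Hpsi psi : test_function l psi ->
    \int[leb]_(x in `]0, l[) ((V x - (- be * x + (ve + be * xe))) * psi x) = 0.
  move=> tpsi; pose A := \int[leb]_(x in `]0, l[) psi x.
  pose psi1 x := psi x - A * eta x.
  have tpsi1 : test_function l psi1 by exact: test_function_subZ.
  have I1 : \int[leb]_(x in `]0, l[) psi1 x = 0.
    rewrite RintegralB//; [|exact: tI|by apply: intgZ => //; exact: tI].
    by rewrite RintegralZl ?Ieta ?mulr1 ?subrr//; exact: tI.
  have [phi tphi dphi] := test_function_primitive tpsi1 I1.
  pose B := \int[leb]_(x in `]0, l[) phi x.
  pose phi1 x := phi x - B * eta x.
  have tphi1 : test_function l phi1 by exact: test_function_subZ.
  have I2 : \int[leb]_(x in `]0, l[) phi1 x = 0.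
    rewrite RintegralB//; [|exact: tI|by apply: intgZ => //; exact: tI].
    by rewrite RintegralZl ?Ieta ?mulr1 ?subrr//; exact: tI.
  have [chi tchi dchi] := test_function_primitive tphi1 I2.
  have dphi1 : derive1 phi1 = (fun x => psi x - A * eta x - B * derive1 eta x).
    apply: derive1_is_derive => x.
    have d1 := smooth_is_derive x (test_function_smooth tphi).
    have d2 := smooth_is_derive x (test_function_smooth teta).
    by rewrite dphi in d1; apply: is_derive_eq.
  have := HV _ tchi; rewrite dchi dphi1.
  (* Integration by parts makes [B] a first moment of [psi1]; thus the integral of V psi depends
     only on the integrals of psi and of x psi, as for an affine function. *)
  have BE : B = - \int[leb]_(x in `]0, l[) ((1 * x + 0) * psi1 x).
    have := test_integral_parts l0 tphi (C1_on_affine l 1 0).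
    rewrite dphi => ->; rewrite opprK; apply: eq_Rintegral => x _.
    by rewrite mul1r.
  have cX : continuous (fun x : R => 1 * x + 0) by case: (C1_on_affine l 1 0).
  have BE2 : B = A * xe - \int[leb]_(x in `]0, l[) ((1 * x + 0) * psi x).
    rewrite BE -RintegralZl//; last exact: tWI.
    apply: oppr_inj; rewrite opprK opprB.
    rewrite -RintegralB//; [|exact: tWI|by apply: intgZ => //; exact: tWI].
    apply: eq_Rintegral => x _; rewrite /psi1; ring.
  have teta' := test_function_derive teta.
  have -> : \int[leb]_(x in `]0, l[)
        (V x * (psi x - A * eta x - B * derive1 eta x)) =
      \int[leb]_(x in `]0, l[) (V x * psi x) - A * ve - B * be.
    rewrite -[A * ve]RintegralZl//; last exact: tWI.
    rewrite -[B * be]RintegralZl//; last exact: tWI.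
    rewrite -RintegralB//; [|exact: tWI|by apply: intgZ => //; exact: tWI].
    rewrite -RintegralB//; [|apply: intgB => //|]; last 3 first.
      exact: tWI.
      by apply: intgZ => //; exact: tWI.
      by apply: intgZ => //; exact: tWI.
    by apply: eq_Rintegral => x _; ring.
  move=> HH.
  have -> : \int[leb]_(x in `]0, l[)
        ((V x - (- be * x + (ve + be * xe))) * psi x) =
      \int[leb]_(x in `]0, l[) (V x * psi x)
      + be * \int[leb]_(x in `]0, l[) ((1 * x + 0) * psi x)
      - (ve + be * xe) * A.
    rewrite -[X in _ + X - _]RintegralZl//; last exact: tWI.
    rewrite -[_ * A]RintegralZl//; last exact: tI.
    rewrite -RintegralD//; [|exact: tWI|by apply: intgZ => //; exact: tWI].
    rewrite -RintegralB//; [|apply: intgD => //|]; last 3 first.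
      exact: tWI.
      by apply: intgZ => //; exact: tWI.
      by apply: intgZ => //; exact: tI.
    by apply: eq_Rintegral => x _; ring.
  by rewrite -[RHS]HH BE2; ring.
have [cA _ _] := C1_on_affine l (- be) (ve + be * xe).
have cVA : continuous (fun x => V x - (- be * x + (ve + be * xe))).
  by move=> x; exact: continuousB (cV x) (cA x).
have HVA x : 0 <= x <= l -> V x - (- be * x + (ve + be * xe)) = 0.
  apply: (ae_eq0_continuous l0 cVA); apply: fundamental_lemma => //.
  exact: intg_continuous.
(* The boundary values of [V] are used here: an affine function vanishing at 0 and at [l] is
   zero. *)
have E0 : ve + be * xe = 0.
  by have := HVA 0; rewrite lexx ltW// V0 mulr0 => /(_ isT); lra.
have E1 : - be = 0.
  have := HVA l; rewrite lexx ltW// Vl E0 => /(_ isT) E1.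
  have : be * l = 0 by lra.
  by move=> /eqP; rewrite mulf_eq0 (gt_eqF l0) orbF => /eqP ->; rewrite oppr0.
by move=> x /HVA; rewrite E0 E1 mul0r addr0 subr0.
Qed.

End Fundamental.

(** * Green operators of z'' - tau z *)

Section Kernel.
Context {R : realType}.
Local Notation leb := (@lebesgue_measure R).
Local Notation RR := (measurableTypeR R).

(** A bounded kernel times p(x) h(y) is integrable on the square, so the order of integration may be
    exchanged. The symmetry of the Green operators rests on this. *)
Lemma Rintegral_fubini (D : set RR) (k : R -> R -> R) (p h : R -> R) (M : R) :
  measurable D ->
  measurable_fun setT (fun z : RR * RR => k z.1 z.2 : RR) ->
  (forall x y, D x -> D y -> `|k x y| <= M) -> intg D p -> intg D h ->
  \int[leb]_(x in D) (p x * \int[leb]_(y in D) (k x y * h y)) =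
  \int[leb]_(y in D) (h y * \int[leb]_(x in D) (k x y * p x)).
Proof.
move=> mD mk kM ip ih.
have mk1 x : measurable_fun setT (k x : RR -> RR).
  exact: (measurableT_comp mk (pair1_measurable x)).
have mk2 y : measurable_fun setT (k ^~ y : RR -> RR).
  exact: (measurableT_comp mk (pair2_measurable y)).
have patchT g : intg D g -> intg setT (g \_ D).
  move=> ig; have := ig; rewrite /intg => /(integrable_mkcond _ mD).
  by rewrite -restrict_EFin.
(* Extending [p] and [h] by zero allows integration over the whole plane although the kernel is
   bounded only on [D] times [D]. *)
pose f (z : RR * RR) : \bar R := ((p \_ D) z.1 * (k z.1 z.2 * (h \_ D) z.2))%:E.
have mp : measurable_fun setT ((p \_ D) : RR -> RR).
  exact: intg_measurable (patchT _ ip).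
have mh : measurable_fun setT ((h \_ D) : RR -> RR).
  exact: intg_measurable (patchT _ ih).
have mf : measurable_fun setT f.
  apply/measurable_EFinP; apply: measurable_funM.
    exact: measurableT_comp.
  by apply: measurable_funM => //; exact: measurableT_comp.
have ikh x : D x -> intg D (fun y => k x y * h y).
  move=> Dx; apply: (@intg_mul_bounded _ _ M) => //.
  - exact: measurable_funTS.
  - by move=> y Dy; exact: kM.
have ikp y : D y -> intg D (fun x => k x y * p x).
  move=> Dy; apply: (@intg_mul_bounded _ _ M) => //.
  - exact: measurable_funTS.
  - by move=> x Dx; exact: kM.
have f1 x : (\int[leb]_y f (x, y))%E =
    ((fun x => p x * \int[leb]_(y in D) (k x y * h y)) \_ D x)%:E.
  rewrite patchE; case: ifPn => [/set_mem Dx|Dx]; last first.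
    rewrite (eq_integral (cst 0%E)) ?integral0// => y _.
    by rewrite /f /= patchE (negbTE Dx) mul0r.
  rewrite -RintegralZl//; last exact: ikh.
  rewrite Rintegral_mkcond /Rintegral fineK; last first.
    apply: integrable_fin_num => //; apply: patchT.
    by apply: intgZ => //; exact: ikh.
  apply: eq_integral => y _; rewrite /f /= !patchE mem_set//.
  by case: ifPn => // _; rewrite !mulr0.
have f2 y : (\int[leb]_x f (x, y))%E =
    ((fun y => h y * \int[leb]_(x in D) (k x y * p x)) \_ D y)%:E.
  rewrite patchE; case: ifPn => [/set_mem Dx|Dx]; last first.
    rewrite (eq_integral (cst 0%E)) ?integral0// => x _.
    by rewrite /f /= [(h \_ _) _]patchE (negbTE Dx) !mulr0.
  rewrite -RintegralZl//; last exact: ikp.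
  rewrite Rintegral_mkcond /Rintegral fineK; last first.
    apply: integrable_fin_num => //; apply: patchT.
    by apply: intgZ => //; exact: ikp.
  apply: eq_integral => x _; rewrite /f /= !patchE [in X in (_ * (_ * X))]mem_set//.
  case: ifPn => // _; rewrite ?mul0r//; congr EFin; ring.
have intf : (leb \x leb)%E.-integrable setT f.
  apply/integrable12ltyP => //.
  pose H : R := \int[leb]_y `|(h \_ D) y|.
  apply: (@le_lt_trans _ _ (\int[leb]_x (`|(p \_ D) x| * (M * H))%:E)%E).
    apply: ge0_le_integral => //.
    - by move=> x _; exact: integral_ge0.
    - apply: (@measurable_fun_fubini_tonelli_F _ _ _ _ _ leb (abse \o f)).
        exact: measurableT_comp.
      by move=> z; rewrite /= lee_fin.
    - by apply/measurable_EFinP; apply: measurable_funM => //; exact: measurableT_comp.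
    move=> x _.
    have ih' : intg setT (fun y => `|(h \_ D) y|) by apply: intg_norm => //; exact: patchT.
    have -> : (`|(p \_ D) x| * (M * H))%:E =
        (\int[leb]_y (`|(p \_ D) x| * (M * `|(h \_ D) y|))%:E)%E.
      rewrite /H -RintegralZl//= -RintegralZl//=; last exact: intgZ.
      rewrite /Rintegral fineK//; apply: integrable_fin_num => //.
      by apply: intgZ => //; exact: intgZ.
    apply: ge0_le_integral => //.
    - apply: measurableT_comp => //; exact: (measurableT_comp mf (pair1_measurable x)).
    - apply/measurable_EFinP; apply: measurable_funM => //.
      by apply: measurable_funM => //; exact: measurableT_comp.
    move=> y _; rewrite lee_fin /f /= !normrM !patchE.
    case: ifPn => [/set_mem Dx|]; last by rewrite normr0 !mul0r.
    case: ifPn => [/set_mem Dy|]; last by rewrite normr0 !mulr0.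
    by rewrite ler_wpM2l// ler_wpM2r// kM.
  rewrite ltey_eq integrable_fin_num//.
  have : intg setT (fun x => (M * H) * `|(p \_ D) x|).
    by apply: intgZ => //; apply: intg_norm => //; exact: patchT.
  by apply: eq_intg => // x _; rewrite mulrC.
have := Fubini intf.
under eq_integral do rewrite f1.
under [RHS]eq_integral do rewrite f2.
move=> FF; rewrite [LHS]Rintegral_mkcond [RHS]Rintegral_mkcond /Rintegral.
by rewrite FF.
Qed.

Definition kern (a b : R -> R) c (x y : R) : R :=
  c^-1 * (a (Num.min x y) * b (Num.max x y)).

(* Freezing x outside [0, l] makes Kop a b c h continuous on the whole line. *)
Definition Kop l (a b : R -> R) c (h : R -> R) (x : R) : R :=
  \int[leb]_(y in `]0, l[) (kern a b c (clamp l x) y * h y).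

Lemma kernC a b c x y : kern a b c x y = kern a b c y x.
Proof. by rewrite /kern minC maxC. Qed.

Lemma kern_bounded l a b c : continuous (a : R -> R) -> continuous (b : R -> R) ->
  exists M, forall x y, 0 <= x <= l -> 0 <= y <= l -> `|kern a b c x y| <= M.
Proof.
move=> ca cb; have [Ma HMa] := continuous_bounded_on_itv 0 l ca.
have [Mb HMb] := continuous_bounded_on_itv 0 l cb.
exists (`|c^-1| * (Ma * Mb)) => x y /andP[x0 xl] /andP[y0 yl].
rewrite /kern !normrM ler_wpM2l// ler_pM//.
- by apply: HMa; rewrite le_min x0 y0 /= ge_min xl.
- by apply: HMb; rewrite le_max x0 /= ge_max xl yl.
Qed.

Lemma measurable_kern a b c : continuous (a : R -> R) -> continuous (b : R -> R) ->
  measurable_fun setT (fun z : RR * RR => kern a b c z.1 z.2 : RR).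
Proof.
move=> ca cb; apply: measurable_funM => //; apply: measurable_funM.
- apply: (measurableT_comp (continuous_measurable_fun ca)).
  by apply: measurable_minr; [exact: measurable_fst|exact: measurable_snd].
- apply: (measurableT_comp (continuous_measurable_fun cb)).
  by apply: measurable_maxr; [exact: measurable_fst|exact: measurable_snd].
Qed.

Lemma kern_continuous a b c y : continuous (a : R -> R) ->
  continuous (b : R -> R) -> continuous (kern a b c ^~ y).
Proof.
move=> ca cb x; apply: cvgM; first exact: cvg_cst.
apply: cvgM.
- apply: (@continuous_comp _ _ _ (fun x => Num.min x y) a); last exact: ca.
  by apply: (@continuous_min _ _ id (cst y)); [exact: cvg_id|exact: cst_continuous].
- apply: (@continuous_comp _ _ _ (fun x => Num.max x y) b); last exact: cb.
  by apply: (@continuous_max _ _ id (cst y)); [exact: cvg_id|exact: cst_continuous].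
Qed.

Lemma measurable_kern1 a b c x : continuous (a : R -> R) ->
  continuous (b : R -> R) -> measurable_fun setT (kern a b c x : RR -> RR).
Proof.
move=> ca cb; have := @kern_continuous a b c x ca cb.
move=> /continuous_measurable_fun; apply: eq_measurable_fun => y _.
exact: kernC.
Qed.

Lemma intg_kern l a b c h x : continuous (a : R -> R) ->
  continuous (b : R -> R) -> intg `]0, l[ h -> 0 <= x <= l ->
  intg `]0, l[ (fun y => kern a b c x y * h y).
Proof.
move=> ca cb ih xl; have [M HM] := kern_bounded l c ca cb.
apply: (@intg_mul_bounded _ _ M) => //.
- by apply: measurable_funTS; exact: measurable_kern1.
- move=> y /=; rewrite in_itv /= => /andP[y0 yl].
  by apply: HM => //; rewrite !ltW.
Qed.

Lemma continuous_Kop l a b c h : 0 < l -> continuous (a : R -> R) ->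
  continuous (b : R -> R) -> intg `]0, l[ h -> continuous (Kop l a b c h).
Proof.
move=> l0 ca cb ih x; have [M HM] := kern_bounded l c ca cb.
have := @continuity_under_integral R _ _ leb
  (fun x y => kern a b c (clamp l x) y * h y) `]0, l[%classic _ (x - 1) (x + 1)
  _ _ (fun y => M * `|h y|) _ _ x.
apply.
- by [].
- by move=> z _; apply: intg_kern => //; exact: clamp_itv.
- apply: aeW => y _ z _; apply: cvgM; last exact: cvg_cst.
  apply: (@continuous_comp _ _ _ (clamp l) (kern a b c ^~ y)).
    exact: continuous_clamp.
  exact: kern_continuous.
- by apply: intgZ => //; exact: intg_norm.
- move=> z _; apply: aeW => y /=; rewrite in_itv /= => /andP[y0 yl].
  rewrite normrM ler_wpM2r// HM ?clamp_itv// !ltW//.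
- by rewrite inE /= in_itv /= ltrBlDr !ltrDl ltr01.
Qed.

Lemma Kop_symmetric l a b c h p : 0 < l -> continuous (a : R -> R) ->
  continuous (b : R -> R) -> intg `]0, l[ h -> intg `]0, l[ p ->
  \int[leb]_(x in `]0, l[) (p x * Kop l a b c h x) =
  \int[leb]_(x in `]0, l[) (h x * Kop l a b c p x).
Proof.
move=> l0 ca cb ih ip.
have [M HM] := kern_bounded l c ca cb.
have E q g : \int[leb]_(x in `]0, l[) (q x * Kop l a b c g x) =
  \int[leb]_(x in `]0, l[) (q x *
    \int[leb]_(y in `]0, l[) (kern a b c x y * g y)).
  apply: eq_Rintegral => x; rewrite inE /= in_itv /= => /andP[x0 xl].
  by rewrite /Kop clamp_id// !ltW.
have mD : measurable (`]0, l[%classic : set RR) by [].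
have HM' x y : `]0, l[%classic x -> `]0, l[%classic y -> `|kern a b c x y| <= M.
  rewrite /= !in_itv /= => /andP[x0 xl] /andP[y0 yl].
  by apply: HM; rewrite !ltW.
rewrite !E (Rintegral_fubini mD (measurable_kern c ca cb) HM' ip ih).
apply: eq_Rintegral => x _; congr (_ * _); apply: eq_Rintegral => y _.
by rewrite kernC.
Qed.


Lemma Kop_boundary l (a b : R -> R) c h : 0 < l -> a 0 = 0 -> b l = 0 ->
  Kop l a b c h 0 = 0 /\ Kop l a b c h l = 0.
Proof.
move=> l0 a0 bl; split; rewrite /Kop clamp_id ?lexx ?ltW//.
- rewrite (@eq_Rintegral _ _ _ _ _ (cst 0)) ?Rintegral_cst ?mul0r// => y.
  rewrite inE /= in_itv /= => /andP[y0 _].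
  by rewrite /kern min_l ?ltW// a0 mul0r mulr0 mul0r.
- rewrite (@eq_Rintegral _ _ _ _ _ (cst 0)) ?Rintegral_cst ?mul0r// => y.
  rewrite inE /= in_itv /= => /andP[_ yl].
  by rewrite /kern max_l ?ltW// bl !mulr0 mul0r.
Qed.

Lemma Rintegral_split l g x : intg `]0, l[ g -> 0 < x < l ->
  \int[leb]_(y in `]0, l[) g y =
  \int[leb]_(y in `]0, x[) g y + \int[leb]_(y in `]x, l[) g y.
Proof.
move=> ig /andP[x0 xl].
have := @Rintegral_itvB R g (BRight 0) (BLeft l) x ig.
rewrite !bnd_simp => /(_ (ltW x0) xl) <-.
rewrite [X in _ = X + _]Rintegral_itv_bndo_bndc ?subrKC//.
apply: integrableS ig => // y /=; rewrite !in_itv /= => /andP[-> yx].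
exact: lt_trans yx xl.
Qed.

(* a and b solve z'' = tau z and vanish at 0 and at l respectively; c is their
   Wronskian, so that kern a b c is the Green function of - z'' + tau z. *)
Record fundamental_pair l (tau : R) (a a' b b' : R -> R) (c : R) : Prop := {
  fp_a : forall x : R, is_derive x 1 a (a' x);
  fp_a' : forall x : R, is_derive x 1 a' (tau * a x);
  fp_b : forall x : R, is_derive x 1 b (b' x);
  fp_b' : forall x : R, is_derive x 1 b' (tau * b x);
  fp_a0 : a 0 = 0;
  fp_bl : b l = 0;
  fp_c : c != 0;
  fp_wronskian : forall x, a' x * b x - a x * b' x = c }.

Lemma is_derive_continuous (f g : R -> R) :
  (forall x : R, is_derive x 1 f (g x)) -> continuous f.
Proof.
move=> df x; apply: differentiable_continuous; apply/derivable1_diffP.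
by case: (df x).
Qed.

(** By Lagrange's identity, a (tau z - z'') = (a' z - a z')', and likewise for [b]; on each side of
    [x] the integral is therefore a boundary term, and the two terms at [x] add up to the Wronskian
    times z(x). *)
Lemma Kop_reproducing l tau a a' b b' c (z z' z'' : R -> R) : 0 < l ->
  fundamental_pair l tau a a' b b' c ->
  C1_on l z z' -> C1_on l z' z'' -> z 0 = 0 -> z l = 0 ->
  forall x, 0 <= x <= l -> Kop l a b c (fun y => tau * z y - z'' y) x = z x.
Proof.
move=> l0 [da da' db db' a0 bl c0 wr] [cz cz' dz] [_ cz'' dz'] z0 zl x.
move=> /andP[]; rewrite le_eqVlt => /predU1P[<- _|x0].
  by rewrite (Kop_boundary c _ l0 a0 bl).1.
rewrite le_eqVlt => /predU1P[->|xl].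
  by rewrite (Kop_boundary c _ l0 a0 bl).2.
have ca := is_derive_continuous da; have ca' := is_derive_continuous da'.
have cb := is_derive_continuous db; have cb' := is_derive_continuous db'.
pose g y := tau * z y - z'' y.
have cg : continuous g.
  move=> y; apply: (@continuousB _ _ _ (fun y => tau * z y) z'').
    by apply: continuousM (cz y); exact: cst_continuous.
  exact: cz''.
have ig : intg `]0, l[ g by exact: intg_continuous.
have xl' : 0 <= x <= l by rewrite !ltW.
rewrite /Kop clamp_id// (@Rintegral_split _ _ x); last 2 first.
- exact: intg_kern.
- by rewrite x0.
have I1 : \int[leb]_(y in `]0, x[) (a y * g y) = a' x * z x - a x * z' x.
  pose F y := a' y * z y - a y * z' y.
  have cF : continuous F.
    move=> y; apply: (@continuousB _ _ _ (fun y => a' y * z y) (fun y => a y * z' y)).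
      exact: continuousM (ca' y) (cz y).
    exact: continuousM (ca y) (cz' y).
  have cf : continuous (fun y => a y * g y).
    by move=> y; exact: continuousM (ca y) (cg y).
  have dF y : 0 < y < x -> is_derive (y : R) 1 F (a y * g y).
    move=> /andP[y0 yx].
    have yl : 0 < y < l by rewrite y0 (lt_trans yx).
    have d1 := dz y yl; have d2 := dz' y yl; have d3 := da y; have d4 := da' y.
    by apply: is_derive_eq; rewrite /GRing.scale /= /g; ring.
  rewrite (FTC2 x0 cF cf dF) /F.
  by rewrite z0 a0 mulr0 mul0r !subr0.
have I2 : \int[leb]_(y in `]x, l[) (b y * g y) = - (b' x * z x - b x * z' x).
  pose F y := b' y * z y - b y * z' y.
  have cF : continuous F.
    move=> y; apply: (@continuousB _ _ _ (fun y => b' y * z y) (fun y => b y * z' y)).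
      exact: continuousM (cb' y) (cz y).
    exact: continuousM (cb y) (cz' y).
  have cf : continuous (fun y => b y * g y).
    by move=> y; exact: continuousM (cb y) (cg y).
  have dF y : x < y < l -> is_derive (y : R) 1 F (b y * g y).
    move=> /andP[y0 yx].
    have yl : 0 < y < l by rewrite yx (lt_trans x0).
    have d1 := dz y yl; have d2 := dz' y yl; have d3 := db y; have d4 := db' y.
    by apply: is_derive_eq; rewrite /GRing.scale /= /g; ring.
  rewrite (FTC2 xl cF cf dF) /F.
  by rewrite zl bl mulr0 mul0r subr0 sub0r.
have iag u v : intg `]u, v[ (fun y => a y * g y).
  by apply: intg_mul_continuous => //; exact: intg_continuous.
have ibg u v : intg `]u, v[ (fun y => b y * g y).
  by apply: intg_mul_continuous => //; exact: intg_continuous.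
have -> : \int[leb]_(y in `]0, x[) (kern a b c x y * (tau * z y - z'' y)) =
    c^-1 * b x * (a' x * z x - a x * z' x).
  rewrite -I1 -RintegralZl//; last exact: iag.
  apply: eq_Rintegral => y.
  rewrite inE /= in_itv /= => /andP[y0 yx].
  by rewrite /kern min_r ?max_l ?ltW//; rewrite /g; ring.
have -> : \int[leb]_(y in `]x, l[) (kern a b c x y * (tau * z y - z'' y)) =
    c^-1 * a x * - (b' x * z x - b x * z' x).
  rewrite -I2 -RintegralZl//; last exact: ibg.
  apply: eq_Rintegral => y.
  rewrite inE /= in_itv /= => /andP[y0 yx].
  by rewrite /kern min_l ?max_r ?ltW//; rewrite /g; ring.
rewrite -[RHS]mul1r -(mulVf c0) -[X in _ = _ * X * _](wr x).
ring.
Qed.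

(** Duality: [phi] is itself reproduced from tau phi - phi'', and symmetry moves the operator over
    to [h]. So -z'' + tau z = h holds weakly although [h] is merely integrable. *)
Lemma Kop_weak l tau a a' b b' c h phi : 0 < l ->
  fundamental_pair l tau a a' b b' c -> intg `]0, l[ h -> test_function l phi ->
  \int[leb]_(x in `]0, l[) (Kop l a b c h x * derive1 (derive1 phi) x) =
  tau * \int[leb]_(x in `]0, l[) (Kop l a b c h x * phi x) -
  \int[leb]_(x in `]0, l[) (h x * phi x).
Proof.
move=> l0 fp ih tphi.
have [da _ db _ _ _ _ _] := fp.
have ca := is_derive_continuous da; have cb := is_derive_continuous db.
have C1 := test_function_C1 tphi.
have C2 := test_function_C1 (test_function_derive tphi).
have [p0 pl] := test_function_bounds tphi.
have rep := Kop_reproducing l0 fp C1 C2 p0 pl.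
have [cp _ _] := C1; have [_ cp'' _] := C2.
have cK := @continuous_Kop l a b c h l0 ca cb ih.
have -> : \int[leb]_(x in `]0, l[) (h x * phi x) =
    \int[leb]_(x in `]0, l[) (h x *
      Kop l a b c (fun y => tau * phi y - derive1 (derive1 phi) y) x).
  apply: eq_Rintegral => x; rewrite inE /= in_itv /= => /andP[x0 xl].
  by rewrite rep// !ltW.
have iK g : continuous g -> intg `]0, l[ (fun x => Kop l a b c h x * g x).
  by move=> cg; apply: intg_mul_continuous => //; exact: intg_continuous.
rewrite -Kop_symmetric//; last first.
  by apply: intgB => //; [apply: intgZ => //|]; exact: intg_continuous.
rewrite -RintegralZl//; last exact: iK.
have -> : \int[leb]_(x in `]0, l[)
      ((tau * phi x - derive1 (derive1 phi) x) * Kop l a b c h x) =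
    \int[leb]_(x in `]0, l[) (tau * (Kop l a b c h x * phi x)) -
    \int[leb]_(x in `]0, l[) (Kop l a b c h x * derive1 (derive1 phi) x).
  rewrite -RintegralB//; [|by apply: intgZ => //; exact: iK|exact: iK].
  by apply: eq_Rintegral => x _; ring.
by rewrite opprB addrC subrK.
Qed.

End Kernel.

(** * The Green operator of the beam *)

Section Green.
Context {R : realType}.
Local Notation leb := (@lebesgue_measure R).
Local Notation RR := (measurableTypeR R).
Implicit Types (l tau : R) (g h : R -> R).

Definition K0 l := Kop l id (fun x : R => l - x) l.

Definition cosh (x : R) : R := (expR x + expR (- x)) / 2.

Definition Ktau l tau := let s := Num.sqrt tau in
  Kop l (fun x => sinh (s * x)) (fun x => sinh (s * (l - x))) (s * sinh (s * l)).

(** Partial fractions: with A = - d^2/dx^2 the beam operator is A (A + tau), and its inverse is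
    tau^-1 times the difference of the inverses of A and of A + tau. *)
Definition Top l tau g (x : R) : R := tau^-1 * (K0 l g x - Ktau l tau g x).

Lemma fundamental_pair0 l : 0 < l ->
  fundamental_pair l 0 id (cst 1) (fun x => l - x) (cst (- 1)) l.
Proof.
move=> l0; split => //=.
- by move=> x; exact: is_derive_id.
- by move=> x; rewrite mul0r; exact: is_derive_cst.
- by move=> x; apply: is_derive_eq; rewrite add0r mul1r.
- by move=> x; rewrite mul0r; exact: is_derive_cst.
- by rewrite subrr.
- by rewrite gt_eqF.
- by move=> x; ring.
Qed.

Lemma is_derive_sinh (x : R) : is_derive x 1 sinh (cosh x).
Proof.
rewrite /sinh /cosh.
have d1 := is_derive_expR x.
have dN : is_derive x (1 : R) (fun y : R => - y) (- 1) by apply: is_derive_eq.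
have d2 := @is_derive1_comp _ _ (fun y : R => - y) _ _ _ (is_derive_expR (- x)) dN.
by apply: is_derive_eq; rewrite /GRing.scale /=; ring.
Qed.

Lemma is_derive_cosh (x : R) : is_derive x 1 cosh (sinh x).
Proof.
rewrite /sinh /cosh.
have d1 := is_derive_expR x.
have dN : is_derive x (1 : R) (fun y : R => - y) (- 1) by apply: is_derive_eq.
have d2 := @is_derive1_comp _ _ (fun y : R => - y) _ _ _ (is_derive_expR (- x)) dN.
by apply: is_derive_eq; rewrite /GRing.scale /=; ring.
Qed.

Lemma sinhN (x : R) : sinh (- x) = - sinh x.
Proof. by rewrite /sinh opprK; ring. Qed.

Lemma sinh0 : sinh 0 = 0 :> R.
Proof. by rewrite /sinh oppr0 subrr mul0r. Qed.

Lemma sinh_gt0 (x : R) : 0 < x -> 0 < sinh x.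
Proof.
move=> x0; rewrite divr_gt0// subr_gt0 ltr_expR.
by rewrite (lt_trans _ x0)// oppr_lt0.
Qed.

Lemma sinhD (x y : R) : sinh (x + y) = cosh x * sinh y + sinh x * cosh y.
Proof.
rewrite /sinh /cosh opprD !expRD !expRN.
have := expR_gt0 x; have := expR_gt0 y.
set X := expR x; set Y := expR y => Y0 X0.
by field; rewrite !gt_eqF.
Qed.

Lemma fundamental_pair_tau l tau : 0 < l -> 0 < tau ->
  let s := Num.sqrt tau in
  fundamental_pair l tau (fun x => sinh (s * x)) (fun x => s * cosh (s * x))
    (fun x => sinh (s * (l - x))) (fun x => - s * cosh (s * (l - x)))
    (s * sinh (s * l)).
Proof.
move=> l0 tau0 s; have s0 : 0 < s by rewrite sqrtr_gt0.
have s2 : tau = s ^+ 2 by rewrite sqr_sqrtr ?ltW.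
have dx (x : R) : is_derive x (1 : R) (fun x => s * x) s.
  by apply: is_derive_eq; rewrite /GRing.scale /= mulr1.
have dlx (x : R) : is_derive x (1 : R) (fun x => s * (l - x)) (- s).
  by apply: is_derive_eq; rewrite /GRing.scale /=; ring.
split.
- move=> x.
  have d := @is_derive1_comp _ _ (fun x => s * x) _ _ _ (is_derive_sinh _) (dx x).
  by apply: is_derive_eq d _; rewrite mulrC.
- move=> x.
  have d := @is_derive1_comp _ _ (fun x => s * x) _ _ _ (is_derive_cosh _) (dx x).
  by apply: is_derive_eq; rewrite /GRing.scale /= s2; ring.
- move=> x.
  have d := @is_derive1_comp _ _ (fun x => s * (l - x)) _ _ _ (is_derive_sinh _) (dlx x).
  by apply: is_derive_eq d _; rewrite mulrC.
- move=> x.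
  have d := @is_derive1_comp _ _ (fun x => s * (l - x)) _ _ _ (is_derive_cosh _) (dlx x).
  by apply: is_derive_eq; rewrite /GRing.scale /= s2; ring.
- by rewrite mulr0 sinh0.
- by rewrite subrr mulr0 sinh0.
- by rewrite gt_eqF// mulr_gt0// sinh_gt0// mulr_gt0.
- move=> x; have -> : s * l = s * x + s * (l - x) by ring.
  by rewrite sinhD; ring.
Qed.

Lemma green_kern l tau (x y : R) : 0 < tau ->
  let s := Num.sqrt tau in
  green l tau x y = tau^-1 * (kern id (fun x => l - x) l x y -
    kern (fun x => sinh (s * x)) (fun x => sinh (s * (l - x)))
      (s * sinh (s * l)) x y).
Proof.
move=> tau0 s; rewrite /green /kern -/s.
have E (t : R) : sinh (s * (t - l)) = - sinh (s * (l - t)).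
  by rewrite -sinhN; congr sinh; ring.
case: leP => yx.
- by rewrite E; congr (_ * _); ring.
- by rewrite E; congr (_ * _); ring.
Qed.

Lemma Top_green l tau g (x : R) : 0 < l -> 0 < tau -> intg `]0, l[ g ->
  0 <= x <= l ->
  \int[leb]_(y in `]0, l[) (green l tau x y * g y) = Top l tau g x.
Proof.
move=> l0 tau0 ig xl.
have [da0 _ db0 _ _ _ _ _] := fundamental_pair0 l0.
have [da _ db _ _ _ _ _] := fundamental_pair_tau l0 tau0.
have i1 := intg_kern l (is_derive_continuous da0) (is_derive_continuous db0) ig xl.
have i2 := intg_kern (Num.sqrt tau * sinh (Num.sqrt tau * l))
  (is_derive_continuous da) (is_derive_continuous db) ig xl.
rewrite /Top /K0 /Ktau /Kop clamp_id//.
rewrite -RintegralB// -RintegralZl//; last exact: intgB.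
by apply: eq_Rintegral => y _; rewrite green_kern//; ring.
Qed.

Lemma K0_continuous l g : 0 < l -> intg `]0, l[ g -> continuous (K0 l g).
Proof.
move=> l0 ig; have [da _ db _ _ _ _ _] := fundamental_pair0 l0.
exact: continuous_Kop (is_derive_continuous da) (is_derive_continuous db) ig.
Qed.

Lemma Ktau_continuous l tau g : 0 < l -> 0 < tau -> intg `]0, l[ g ->
  continuous (Ktau l tau g).
Proof.
move=> l0 t0 ig; have [da _ db _ _ _ _ _] := fundamental_pair_tau l0 t0.
exact: continuous_Kop (is_derive_continuous da) (is_derive_continuous db) ig.
Qed.

Lemma K0_boundary l g : 0 < l -> K0 l g 0 = 0 /\ K0 l g l = 0.
Proof. by move=> l0; apply: Kop_boundary => //=; rewrite subrr. Qed.

Lemma primitive l (psi : R -> R) : 0 < l -> continuous psi ->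
  exists2 F, C1_on l F psi & F 0 = 0.
Proof.
(* Starting the integral at -1 makes [G] differentiable at 0 as well, hence continuous on all of
   [0, l]. *)
move=> l0 cpsi; pose G (x : R) : R := \int[leb]_(t in `[-1, x]) psi t.
have dG (x : R) : -1 < x -> is_derive x (1 : R) G (psi x).
  move=> x1; have xx1 : x < x + 1 by rewrite ltrDl.
  have ipsi : leb.-integrable `[-1, x + 1] (EFin \o psi).
    apply: continuous_compact_integrable; first exact: segment_compact.
    exact: continuous_subspaceT.
  have [d1 d2] := continuous_FTC1_closed xx1 ipsi x1 (cpsi x).
  by split; [exact: d1|rewrite -d2 derive1E].
exists (fun x => G (clamp l x) - G 0); last by rewrite clamp_id ?subrr// lexx ltW.
have CG : C1_on l (G \o clamp l) psi.
  split; [|exact: cpsi|].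
  - apply: continuous_comp_clamp => //; apply: continuous_in_subspaceT => x.
    rewrite inE /= in_itv /= => /andP[x0 _].
    have [d _] : is_derive x (1 : R) G (psi x) by apply: dG; rewrite (lt_le_trans _ x0).
    exact/differentiable_continuous/derivable1_diffP.
  - have GE (x : R) : 0 < x < l -> G x = (G \o clamp l) x.
      by move=> /andP[x0 xl]; rewrite /= clamp_id// !ltW.
    apply: (is_derive_eq_itv GE) => x /andP[x0 _].
    by apply: dG; rewrite (lt_trans _ x0).
have CC : C1_on l (cst (- G 0)) (cst 0).
  split; [exact: cst_continuous..|].
  by move=> x _; exact: is_derive_cst.
have [c1 _ d] := C1_on_add CG CC; split => // x xl.
by apply: is_derive_eq (d x xl) _; rewrite /= addr0.
Qed.

(** Twice integrating [psi] by hand gives a function with second derivative -psi and zero boundary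
    values; the reproducing property identifies it with K0 psi. *)
Lemma K0_C2 l (psi : R -> R) : 0 < l -> continuous psi ->
  exists2 z', C1_on l (K0 l psi) z' & C1_on l z' (fun x => - psi x).
Proof.
move=> l0 cpsi; have [F CF F0] := primitive l0 cpsi.
have cF : continuous F by case: CF.
have [F2 CF2 F20] := primitive l0 cF.
(* The slope makes z(l) = 0. *)
pose z x := (F2 l / l) * x + 0 - F2 x.
pose z' x := cst (F2 l / l) x - F x.
have Cz : C1_on l z z' by exact: C1_on_sub (C1_on_affine l _ 0) CF2.
have Cz' : C1_on l z' (fun x => - psi x).
  have CC : C1_on l (cst (F2 l / l)) (cst 0).
    split; [exact: cst_continuous..|].
    by move=> x _; exact: is_derive_cst.
  have [c1 c2 d] := C1_on_sub CC CF.
  split; first exact: c1.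
  - by move=> x; exact: continuousN (cpsi x).
  - by move=> x xl; apply: is_derive_eq (d x xl) _; rewrite /= sub0r.
have z0 : z 0 = 0 by rewrite /z mulr0 F20 addr0 subr0.
have zl : z l = 0 by rewrite /z divfK ?gt_eqF// addr0 subrr.
have KE x : 0 <= x <= l -> K0 l psi x = z x.
  move=> xl; have := Kop_reproducing l0 (fundamental_pair0 l0) Cz Cz' z0 zl xl.
  move=> <-; rewrite /K0; congr (Kop _ _ _ _ _ _).
  by apply/funext => y; rewrite mul0r sub0r opprK.
exists z' => //; split.
- exact/K0_continuous/intg_continuous.
- by case: Cz.
- have KE' x : 0 < x < l -> z x = K0 l psi x.
    by move=> /andP[x0 xl]; rewrite KE// !ltW.
  by apply: (is_derive_eq_itv KE'); case: Cz.
Qed.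

(* W'''' - tau W'' = g on ]0, l[ with the boundary conditions of the beam,
   integrated twice: since K0 inverts the second derivative up to sign, the
   equation says that W'' = tau W - K0 g. *)
Definition beam_sol l tau g (W W' : R -> R) :=
  [/\ C1_on l W W', C1_on l W' (fun x => tau * W x - K0 l g x), W 0 = 0 & W l = 0].

(** Since [g] is only integrable, K0 g and Ktau g are known to be continuous but not yet
    differentiable. Weakly, W'' = - psi with [psi] continuous, so [W] has the same weak second
    derivative and boundary values as the C^2 function K0 psi, and du Bois-Reymond makes them
    equal. *)
Lemma Top_beam l tau g : 0 < l -> 0 < tau -> intg `]0, l[ g ->
  exists W', beam_sol l tau g (Top l tau g) W'.
Proof.
move=> l0 t0 ig; set W := Top l tau g.
have cK0 := K0_continuous l0 ig; have cKt := Ktau_continuous l0 t0 ig.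
have cW : continuous W.
  move=> x; apply: (@continuousM _ _ (cst tau^-1) (fun x => K0 l g x - Ktau l tau g x)).
    exact: cst_continuous.
  exact: continuousB (cK0 x) (cKt x).
have fp0 := fundamental_pair0 l0; have fpt := fundamental_pair_tau l0 t0.
have [K00 K0l] := K0_boundary g l0.
have [Kt0 Ktl] : Ktau l tau g 0 = 0 /\ Ktau l tau g l = 0.
  by apply: Kop_boundary => //; [exact: fp_a0 fpt|exact: fp_bl fpt].
have W0 : W 0 = 0 by rewrite /W /Top K00 Kt0 subrr mulr0.
have Wl : W l = 0 by rewrite /W /Top K0l Ktl subrr mulr0.
pose psi x := K0 l g x - tau * W x.
have cpsi : continuous psi.
  move=> x; apply: (@continuousB _ _ _ (K0 l g) (fun x => tau * W x)).
    exact: cK0.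
  by apply: continuousM (cW x); exact: cst_continuous.
have ipsi : intg `]0, l[ psi by exact: intg_continuous.
have [Kp0 Kpl] := K0_boundary psi l0.
have cKp := K0_continuous l0 ipsi.
have WE : forall x, 0 <= x <= l -> W x - K0 l psi x = 0.
  apply: (@du_bois_reymond2 _ l (fun x => W x - K0 l psi x)) => //.
  - by move=> y; exact: continuousB (cW y) (cKp y).
  - by rewrite W0 Kp0 subrr.
  - by rewrite Wl Kpl subrr.
  move=> phi tphi.
  have [cp _ _] := test_function_C1 tphi.
  have [_ cp'' _] := test_function_C1 (test_function_derive tphi).
  have w0 := Kop_weak l0 fp0 ig tphi; have wt := Kop_weak l0 fpt ig tphi.
  have wp := Kop_weak l0 fp0 ipsi tphi.
  rewrite -/(K0 l g) in w0; rewrite -/(Ktau l tau g) in wt.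
  rewrite -/(K0 l psi) in wp.
  have I F G : continuous (F : R -> R) -> continuous (G : R -> R) ->
      intg `]0, l[ (fun x => F x * G x).
    by move=> cF cG; apply: intg_mul_continuous => //; exact: intg_continuous.
  set J1 := \int[leb]_(x in `]0, l[) (K0 l g x * phi x) in w0 *.
  set J2 := \int[leb]_(x in `]0, l[) (Ktau l tau g x * phi x) in wt *.
  set J3 := \int[leb]_(x in `]0, l[) (g x * phi x) in w0 wt.
  have -> : \int[leb]_(x in `]0, l[) ((W x - K0 l psi x) * derive1 (derive1 phi) x) =
    tau^-1 * (\int[leb]_(x in `]0, l[) (K0 l g x * derive1 (derive1 phi) x) -
      \int[leb]_(x in `]0, l[) (Ktau l tau g x * derive1 (derive1 phi) x)) -
    \int[leb]_(x in `]0, l[) (K0 l psi x * derive1 (derive1 phi) x).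
    rewrite -RintegralB//; [|exact: I..].
    rewrite -RintegralZl//; last by apply: intgB => //; exact: I.
    rewrite -RintegralB//; last exact: I.
      by apply: eq_Rintegral => x _; rewrite /W /Top; ring.
    by apply: intgZ => //; apply: intgB => //; exact: I.
  (* Solving the definition of [Top] for Ktau g shows that [psi] is Ktau g itself. *)
  have J4 : \int[leb]_(x in `]0, l[) (psi x * phi x) = J2.
    apply: eq_Rintegral => x _; congr (_ * _).
    by rewrite /psi /W /Top; field; rewrite gt_eqF.
  rewrite w0 wt wp J4; field; rewrite gt_eqF//.
have [z' Cz' Cz''] := K0_C2 l0 cpsi.
have WE' x : 0 < x < l -> K0 l psi x = W x.
  move=> /andP[x0 xl]; apply/eqP; rewrite eq_sym -subr_eq0 WE// !ltW//.
exists z'; split => //.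
- split => //; first by case: Cz'.
  by apply: (is_derive_eq_itv WE'); case: Cz'.
- rewrite (_ : (fun _ => _) = (fun x => - psi x))//.
  by apply/funext => x; rewrite /psi opprB.
Qed.

End Green.

(** * The energy estimate *)

Section Energy.
Context {R : realType}.
Local Notation leb := (@lebesgue_measure R).
Local Notation RR := (measurableTypeR R).
Implicit Types (l tau alpha : R) (f g h s : R -> R).

Lemma K0_sub l g h : 0 < l -> intg `]0, l[ g -> intg `]0, l[ h ->
  forall x, K0 l (fun y => g y - h y) x = K0 l g x - K0 l h x.
Proof.
move=> l0 ig ih x; have xl := clamp_itv x l0.
have [da _ db _ _ _ _ _] := fundamental_pair0 l0.
have i1 := intg_kern l (is_derive_continuous da) (is_derive_continuous db) ig xl.
have i2 := intg_kern l (is_derive_continuous da) (is_derive_continuous db) ih xl.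
rewrite /K0 /Kop -RintegralB//.
by apply: eq_Rintegral => y _; ring.
Qed.

Lemma integral_product_parts l (F F' G G' : R -> R) : 0 < l ->
  C1_on l F F' -> C1_on l G G' -> F 0 = 0 -> F l = 0 ->
  \int[leb]_(x in `]0, l[) (F x * G' x) = - \int[leb]_(x in `]0, l[) (F' x * G x).
Proof.
move=> l0 CF CG F0 Fl.
have := integral_C1 l0 (C1_on_mul CF CG); rewrite /= F0 Fl !mul0r subr0.
case: CF => cF cf _; case: CG => cG cg _.
rewrite RintegralD//; last 2 first.
- by apply: intg_mul_continuous => //; exact: intg_continuous.
- by apply: intg_mul_continuous => //; exact: intg_continuous.
by move=> /eqP; rewrite addrC addr_eq0 => /eqP.
Qed.

(** Each term of the equation is multiplied by D'' and integrated. The first two give -|D'|^2 and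
    -(W', D') by parts; in the last, symmetry turns (D'', K0 h) into (h, K0 D''), and K0 D'' = - D.
    No derivative of [h] appears. *)
Lemma energy l tau (sigma : R) h (D D' W W' : R -> R) : 0 < l ->
  C1_on l D D' -> C1_on l D' (fun x => tau * D x + sigma * W x - K0 l h x) ->
  D 0 = 0 -> D l = 0 -> C1_on l W W' -> W 0 = 0 -> W l = 0 -> intg `]0, l[ h ->
  \int[leb]_(x in `]0, l[) ((tau * D x + sigma * W x - K0 l h x) ^+ 2)
    + tau * \int[leb]_(x in `]0, l[) (D' x ^+ 2) =
  \int[leb]_(x in `]0, l[) (D x * h x)
    - sigma * \int[leb]_(x in `]0, l[) (W' x * D' x).
Proof.
move=> l0 CD CD'; set D'' := (fun x => _ - _) in CD' *.
move=> D0 Dl CW W0 Wl ih.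
have [cD cD' _] := CD; have [_ cD'' _] := CD'; have [cW cW' _] := CW.
have I F G : continuous (F : R -> R) -> continuous (G : R -> R) ->
    intg `]0, l[ (fun x => F x * G x).
  by move=> cF cG; apply: intg_mul_continuous => //; exact: intg_continuous.
have cK := K0_continuous l0 ih.
have E1 := integral_product_parts l0 CD CD' D0 Dl.
have E2 := integral_product_parts l0 CW CD' W0 Wl.
have E3 : \int[leb]_(x in `]0, l[) (D'' x * K0 l h x) =
    - \int[leb]_(x in `]0, l[) (D x * h x).
  have iD'' : intg `]0, l[ D'' by exact: intg_continuous.
  have [da _ db _ _ _ _ _] := fundamental_pair0 l0.
  rewrite /K0 (Kop_symmetric l l0 (is_derive_continuous da)
    (is_derive_continuous db) ih iD'').
  have rep := Kop_reproducing l0 (fundamental_pair0 l0) CD CD' D0 Dl.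
  rewrite -[RHS]mulN1r -RintegralZl//; last exact: intg_mul_continuous.
  apply: eq_Rintegral => x; rewrite inE /= in_itv /= => /andP[x0 xl].
  have xl' : 0 <= x <= l by rewrite !ltW.
  have <- : - D x = Kop l id (fun x => l - x) l D'' x; last by ring.
  rewrite -(rep x xl') /Kop -mulN1r -RintegralZl//.
    by apply: eq_Rintegral => y _; ring.
  apply: intg_kern (is_derive_continuous da) (is_derive_continuous db) _ _.
    apply: intgB => //; apply: intgZ => //; exact: intg_continuous.
  exact: clamp_itv.
rewrite (_ : \int[leb]_(x in `]0, l[) (D'' x ^+ 2) =
   tau * \int[leb]_(x in `]0, l[) (D x * D'' x) +
   sigma * \int[leb]_(x in `]0, l[) (W x * D'' x) -
   \int[leb]_(x in `]0, l[) (D'' x * K0 l h x)); last first.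
  rewrite -!RintegralZl//; [|exact: I..].
  rewrite -RintegralD//; [|by apply: intgZ => //; exact: I..].
  rewrite -RintegralB//; [|by apply: intgD => //; apply: intgZ => //; exact: I|exact: I].
  by apply: eq_Rintegral => x _; rewrite /D''; ring.
rewrite E1 E2 E3.
have -> : \int[leb]_(x in `]0, l[) (D' x ^+ 2) = \int[leb]_(x in `]0, l[) (D' x * D' x).
  by apply: eq_Rintegral => x _; ring.
ring.
Qed.

(** D' satisfies no boundary condition, so Wirtinger's inequality does not apply to it directly.
    Instead |D'|^2 = - (D, D'') <= |D| |D''|, and the inequality for [D] bounds |D| by l/pi |D'|. *)
Lemma nrm_C1_boundary l (D D' D'' : R -> R) : 0 < l ->
  C1_on l D D' -> C1_on l D' D'' -> D 0 = 0 -> D l = 0 ->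
  pi / l * nrm l D' <= nrm l D''.
Proof.
move=> l0 CD CD' D0 Dl.
have W1 := wirtinger l0 CD D0 Dl.
have [cD cD' _] := CD; have [_ cD'' _] := CD'.
have E := integral_product_parts l0 CD CD' D0 Dl.
have CS := cauchy_schwarz (continuous_sqi 0 l cD) (continuous_sqi 0 l cD'').
have N2 : nrm l D' ^+ 2 <= nrm l D * nrm l D''.
  rewrite nrm_sqr; apply: le_trans CS.
  rewrite (_ : \int[leb]_(x in `]0, l[) (D' x ^+ 2) =
    - \int[leb]_(x in `]0, l[) (D x * D'' x)); last first.
    by rewrite E opprK; apply: eq_Rintegral => x _; ring.
  by rewrite -normrN ler_norm.
have [->|n0] := eqVneq (nrm l D') 0; first by rewrite mulr0 nrm_ge0.
have np : 0 < nrm l D' by rewrite lt_def n0 nrm_ge0.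
have pi0 : 0 < pi :> R by exact: pi_gt0.
have : nrm l D' * nrm l D' <= l / pi * nrm l D'' * nrm l D'.
  by rewrite -expr2 (le_trans N2)// mulrAC ler_wpM2r// nrm_ge0.
rewrite ler_pM2r// => H; rewrite mulrAC ler_pdivrMr// mulrC.
by move: H; rewrite mulrAC ler_pdivlMr// [l * _]mulrC mulrC.
Qed.

Lemma energy_lower l alpha tau (sigma : R) h (D D' W W' : R -> R) : 0 < l ->
  alpha <= tau ->
  C1_on l D D' -> C1_on l D' (fun x => tau * D x + sigma * W x - K0 l h x) ->
  D 0 = 0 -> D l = 0 -> C1_on l W W' -> W 0 = 0 -> W l = 0 -> sqi `]0, l[ h ->
  (alpha + (pi / l) ^+ 2) * nrm l D' <= l / pi * nrm l h + `|sigma| * nrm l W'.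
Proof.
move=> l0 at_ CD CD' D0 Dl CW W0 Wl sh.
have E := energy l0 CD CD' D0 Dl CW W0 Wl (sqi_intg sh).
have N := nrm_C1_boundary l0 CD CD' D0 Dl.
have pi0 : 0 < pi :> R by exact: pi_gt0.
have [cD cD' _] := CD; have [_ cW' _] := CW.
have C1 := cauchy_schwarz (continuous_sqi 0 l cD) sh.
have C2 := cauchy_schwarz (continuous_sqi 0 l cW') (continuous_sqi 0 l cD').
have W1 := wirtinger l0 CD D0 Dl.
rewrite -!nrm_sqr in E.
set N2 := nrm l (fun x => _ - _) in E N.
have [n0|n0] := eqVneq (nrm l D') 0.
  by rewrite n0 mulr0 addr_ge0// mulr_ge0 ?nrm_ge0// divr_ge0// ltW.
have np : 0 < nrm l D' by rewrite lt_def n0 nrm_ge0.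
rewrite -(ler_pM2r np).
have NN : (pi / l * nrm l D') ^+ 2 <= N2 ^+ 2.
  by rewrite ler_sqr ?nnegrE ?nrm_ge0// mulr_ge0 ?nrm_ge0// divr_ge0// ltW.
apply: (@le_trans _ _ (N2 ^+ 2 + tau * nrm l D' ^+ 2)).
  have H := ler_wpM2r (sqr_ge0 (nrm l D')) at_.
  rewrite exprMn in NN; lra.
rewrite E (le_trans (lerD (ler_norm _) (ler_norm _)))// normrN normrM.
rewrite mulrDl lerD//; last by rewrite -mulrA ler_wpM2l.
by apply: (le_trans C1); rewrite mulrAC ler_wpM2r// nrm_ge0.
Qed.

Lemma nrmD l f g : sqi `]0, l[ f -> sqi `]0, l[ g ->
  nrm l (fun x => f x + g x) <= nrm l f + nrm l g.
Proof.
move=> sf sg; have mD : measurable (`]0, l[%classic : set RR) by [].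
have fg := intg_mul_sqi mD sf sg; have CS := cauchy_schwarz sf sg.
rewrite -ler_sqr ?nnegrE ?addr_ge0 ?nrm_ge0// sqrrD !nrm_sqr.
case: sf => mf fi; case: sg => mg gi.
have -> : \int[leb]_(x in `]0, l[) ((f x + g x) ^+ 2) =
  \int[leb]_(x in `]0, l[) (f x ^+ 2) + 2 * \int[leb]_(x in `]0, l[) (f x * g x)
  + \int[leb]_(x in `]0, l[) (g x ^+ 2).
  rewrite -RintegralZl// -RintegralD//; last exact: intgZ.
  rewrite -RintegralD//; last by apply: intgD => //; exact: intgZ.
  by apply: eq_Rintegral => x _; ring.
have := ler_norm (\int[leb]_(x in `]0, l[) (f x * g x)); lra.
Qed.

Lemma nrmZ l (c : R) f : sqi `]0, l[ f ->
  nrm l (fun x => c * f x) = `|c| * nrm l f.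
Proof.
move=> [_ fi]; rewrite /nrm -sqrtr_sqr -sqrtrM ?sqr_ge0//; congr Num.sqrt.
by rewrite -RintegralZl//; apply: eq_Rintegral => x _; ring.
Qed.

Lemma nrm_norm l f : nrm l (fun x => `|f x|) = nrm l f.
Proof.
rewrite /nrm; congr Num.sqrt; apply: eq_Rintegral => x _.
by rewrite real_normK ?num_real.
Qed.

Lemma sqi_norm l f : sqi `]0, l[ f -> sqi `]0, l[ (fun x => `|f x|).
Proof.
move=> [mf fi]; split; first exact: measurableT_comp.
by apply: eq_intg fi => // x _; rewrite real_normK ?num_real.
Qed.

Lemma nrm_ae_le l f g : measurable_fun (`]0, l[%classic : set RR) (f : RR -> RR) ->
  sqi `]0, l[ g ->
  {ae leb, forall x : R, `]0, l[%classic x -> `|f x| <= g x} ->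
  sqi `]0, l[ f /\ nrm l f <= nrm l g.
Proof.
move=> mf [mg gi] fg.
have mf2 : measurable_fun (`]0, l[%classic : set RR) (fun x => f x ^+ 2 : RR).
  exact: measurable_funX.
have mg2 : measurable_fun (`]0, l[%classic : set RR) (fun x => g x ^+ 2 : RR).
  exact: measurable_funX.
have H : (\int[leb]_(x in `]0%R, l[%classic) (f x ^+ 2)%:E <=
          \int[leb]_(x in `]0%R, l[%classic) (g x ^+ 2)%:E)%E.
  apply: ae_ge0_le_integral => //.
  - by move=> x _; rewrite lee_fin sqr_ge0.
  - exact/measurable_EFinP.
  - by move=> x _; rewrite lee_fin sqr_ge0.
  - exact/measurable_EFinP.
  - case: fg => N [mN N0 sN]; exists N; split => // x /= Hx; apply: sN => /= Hfg.
    apply: Hx => xl; rewrite lee_fin -(real_normK (num_real (f x))).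
    by rewrite ler_sqr ?nnegrE// ?Hfg// (le_trans _ (Hfg xl)).
have gfin := integrable_fin_num _ gi.
have Hlt : (\int[leb]_(x in `]0%R, l[%classic) (f x ^+ 2)%:E < +oo)%E.
  by rewrite (le_lt_trans H)// ltey_eq gfin.
have fi : intg `]0, l[ (fun x => f x ^+ 2).
  apply/integrableP; split; first exact/measurable_EFinP.
  apply: le_lt_trans Hlt; rewrite le_eqVlt; apply/orP; left; apply/eqP.
  by apply: eq_integral => x _; rewrite /= ger0_norm ?sqr_ge0.
split; first by split.
by rewrite /nrm ler_wsqrtr// /Rintegral fine_le//; exact: integrable_fin_num.
Qed.

(** Cauchy-Schwarz for (f - g)(f + g). It controls the change in the argument of [m], which is a
    squared norm. *)
Lemma nrm_sqr_sub l f g : sqi `]0, l[ f -> sqi `]0, l[ g ->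
  `|nrm l f ^+ 2 - nrm l g ^+ 2| <=
  nrm l (fun x => f x - g x) * (nrm l f + nrm l g).
Proof.
move=> sf sg; have mD : measurable (`]0, l[%classic : set RR) by [].
have CS := cauchy_schwarz (sqiB mD sf sg) (sqiD mD sf sg).
rewrite !nrm_sqr -RintegralB//; [|by case: sf|by case: sg].
have -> : \int[leb]_(x in `]0, l[) (f x ^+ 2 - g x ^+ 2) =
    \int[leb]_(x in `]0, l[) ((f x - g x) * (f x + g x)).
  by apply: eq_Rintegral => x _; ring.
by rewrite (le_trans CS)// ler_wpM2l ?nrm_ge0// nrmD.
Qed.

End Energy.

(** * Lebesgue norms and superposition operators *)

Section LpFacts.
Context {R : realType}.
Local Notation leb := (@lebesgue_measure R).
Local Notation RR := (measurableTypeR R).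
Implicit Types (l : R) (g h : R -> R).

Definition ae_eq_on l g h :=
  {ae leb, forall x : R, `]0, l[%classic x -> g x = h x}.

Lemma ae_eq_on_sym l g h : ae_eq_on l g h -> ae_eq_on l h g.
Proof.
by move=> [N [mN N0 sN]]; exists N; split => // x /= Hx; apply: sN => /= H;
  apply: Hx => /H.
Qed.

Lemma ae_eq_on_trans l f g h : ae_eq_on l f g -> ae_eq_on l g h -> ae_eq_on l f h.
Proof.
move=> [N [mN N0 sN]] [N' [mN' N0' sN']]; exists (N `|` N'); split.
- exact: measurableU.
- by rewrite measureU0.
move=> x /= Hx; have [Nx|Nx] := pselect (N x); [by left|right].
apply: sN' => /= H'; apply: Hx => xl; rewrite -(H' xl).
by apply: contrapT => fg; apply: Nx; apply: sN => /= /(_ xl).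
Qed.

Lemma in_Lp2_sqi l g : in_Lp l 2%:E g -> exists2 h, sqi `]0, l[ h & ae_eq_on l g h.
Proof.
move=> [h hL gh]; exists h => //.
have mD : measurable (`]0, l[%classic : set RR) by [].
have iT : leb.-integrable setT (EFin \o (fun x => (h \_ `]0, l[) x ^+ 2)).
  exact: Lfun2_integrable_sqr.
split.
  have mh : measurable_fun setT (h \_ `]0, l[ : RR -> RR).
    by have /andP[] := hL; rewrite inE.
  have /(measurable_restrict _ mD measurableT) := mh.
  by rewrite setTI.
have : intg `]0, l[ (fun x => (h \_ `]0, l[) x ^+ 2) by exact: integrableS iT.
by apply: eq_intg => // x Dx; rewrite patchE mem_set.
Qed.

Lemma sqi_in_Lp2 l g h : sqi `]0, l[ h -> ae_eq_on l g h -> in_Lp l 2%:E g.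
Proof.
move=> [mh ih] gh; exists h => //.
have mD : measurable (`]0, l[%classic : set RR) by [].
have mhD : measurable_fun setT (h \_ `]0, l[ : RR -> RR).
  by apply/(measurable_restrict _ mD measurableT); rewrite setTI.
rewrite inE; apply/andP; split; first by rewrite inE.
rewrite inE /= /finite_norm unlock; apply: poweR_lty.
rewrite (_ : (\int[_]_x _)%E = (\int[leb]_(x in `]0%R, l[%classic) (h x ^+ 2)%:E)%E).
  by rewrite ltey_eq (integrable_fin_num mD ih).
rewrite [RHS]integral_mkcond; apply: eq_integral => x _; rewrite /= !patchE.
case: ifPn => _; rewrite ?normr0 /=; last by rewrite powR0.
by rewrite powR_mulrn// real_normK ?num_real.
Qed.

Lemma Lp_norm2 l g h : sqi `]0, l[ h -> ae_eq_on l g h ->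
  Lp_norm l 2%:E g = nrm l h.
Proof.
move=> [mh ih] gh; have mD : measurable (`]0, l[%classic : set RR) by [].
rewrite /Lp_norm unlock.
have -> : (\int[leb]_x `|(EFin \o g \_ `]0%R, l[%classic) x| `^ 2)%E =
    (\int[leb]_(x in `]0%R, l[%classic) (h x ^+ 2)%:E)%E.
  rewrite [RHS]integral_mkcond; apply: integral_ae.
  case: gh => N [mN N0 sN]; exists N; split => // x /= Hx; apply: sN => /= H.
  apply: Hx => _; rewrite !patchE.
  case: ifPn => [/set_mem xD|_]; rewrite ?normr0 /=; last by rewrite powR0.
  by rewrite (H xD) powR_mulrn// real_normK ?num_real.
rewrite -[X in (X `^ _)%E]fineK; last exact: integrable_fin_num.
rewrite /= powR12_sqrt//.
by apply: Rintegral_ge0 => x _; exact: sqr_ge0.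
Qed.

Lemma Lp_normoo_ge l g : in_Lp l +oo%E g ->
  {ae leb, forall x : R, `]0, l[%classic x -> `|g x| <= Lp_norm l +oo%E g}.
Proof.
move=> [h hL gh].
(* The norm at infinity is defined by cases on the measure of the whole space; positivity selects
   the essential supremum. *)
have leb_gt0 : (0 < leb [set: R])%E.
  rewrite (@lt_le_trans _ _ (leb `]0%R, 1%R[%classic))//.
    by rewrite lebesgue_measure_itv /= lte_fin ltr01 -EFinB subr0 lte_fin.
  by apply: le_measure; rewrite ?inE.
have NE : Lnorm leb +oo%E (EFin \o (g \_ `]0, l[)) =
          Lnorm leb +oo%E (EFin \o (h \_ `]0, l[)).
  rewrite unlock leb_gt0; apply: eq_ess_sup.
  case: gh => N [mN N0 sN]; exists N; split => // x /= Hx; apply: sN => /= H.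
  apply: Hx; rewrite !patchE; case: ifPn => [/set_mem xD|//].
  by rewrite (H xD).
(* [Lp_norm] applies [fine], which sends an infinite value to 0; finiteness is what makes it an
   actual bound. *)
have fin : Lnorm leb +oo%E (EFin \o (g \_ `]0, l[)) \is a fin_num.
  rewrite ge0_fin_numE ?Lnorm_ge0// NE.
  by move: hL; rewrite inE => /andP[_]; rewrite inE.
have := ess_sup_ge leb (abse \o (EFin \o (g \_ `]0, l[))).
move=> [N [mN N0 sN]]; exists N; split => // x /= Hx; apply: sN => /= H.
apply: Hx => xD; rewrite -lee_fin /Lp_norm fineK//.
move: H; rewrite unlock leb_gt0 /= patchE mem_set//.
Qed.

Lemma Lp_norm_ge0 l p g : 0 <= Lp_norm l p g.
Proof. by apply: fine_ge0; exact: Lnorm_ge0. Qed.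

(** * Measurability of superpositions *)

Lemma measurable_floor (g : RR -> RR) (D : set RR) (i : int) : measurable D ->
  measurable_fun D g -> measurable (D `&` [set x | Num.floor (g x : R) = i]).
Proof.
move=> mD mg; rewrite (_ : [set x | _] = g @^-1` `[i%:~R, (i + 1)%:~R[%classic).
  exact: mg.
apply/seteqP; split => x /=; rewrite in_itv /=.
- by move=> /eqP; rewrite floor_eq.
- by move=> H; apply/eqP; rewrite floor_eq.
Qed.

(** The two floors take countably many values, so a preimage is a countable union of pieces on which
    both indices are fixed. *)
Lemma measurable_fun_int2 (D : set RR) (H : int -> int -> RR -> RR)
    (p q : RR -> RR) : measurable D ->
  (forall i j, measurable_fun D (H i j)) -> measurable_fun D p ->
  measurable_fun D q ->
  measurable_fun D (fun x => H (Num.floor (p x : R)) (Num.floor (q x : R)) x).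
Proof.
move=> mD mH mp mq _ Y mY.
rewrite (_ : _ `&` _ = \bigcup_(ij : int * int)
   ((D `&` [set x | Num.floor (p x : R) = ij.1]) `&`
    (D `&` [set x | Num.floor (q x : R) = ij.2]) `&`
    (D `&` H ij.1 ij.2 @^-1` Y))).
  apply: countable_bigcupT_measurable; first exact: countableP.
  move=> [i j]; apply: measurableI; last exact: mH.
  by apply: measurableI; exact: measurable_floor.
apply/seteqP; split => x /=.
- move=> [Dx HY].
  by exists (Num.floor (p x : R), Num.floor (q x : R)).
- by move=> [[i j] _ [[[Dx <-] [_ <-]] [_]]].
Qed.

Definition grid (n : nat) (t : R) : R := (Num.floor (t * n.+1%:R))%:~R / n.+1%:R.

Lemma grid_cvg t : (fun n => grid n t) @ \oo --> t.
Proof.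
apply/cvgrPdist_le => e e0; near=> n.
have n0 : 0 < n.+1%:R :> R by [].
have /andP[f1 f2] := floor_itv (t * n.+1%:R : R).
rewrite intrD in f2; rewrite /grid; set F := (Num.floor _)%:~R in f1 f2 *.
have -> : t - F / n.+1%:R = (t * n.+1%:R - F) / n.+1%:R.
  by rewrite mulrBl mulfK// gt_eqF.
rewrite ger0_norm; last by rewrite divr_ge0// subr_ge0.
apply: (@le_trans _ _ n.+1%:R^-1).
  by rewrite ler_pdivrMr// mulVf ?gt_eqF//; lra.
apply/ltW; near: n; exact: (near_infty_natSinv_lt (PosNum e0)).
Unshelve. all: by end_near. Qed.

(* f is measurable in its first argument and continuous in the last two, so it is
   the limit of its values at the points of finer and finer grids, which are
   measurable after the removal of countably many null sets. *)
Lemma caratheodory l (f : R -> R -> R -> R) (l2 l3 u v : R -> R) :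
  (forall a b, in_Lp l 2%:E (fun x => f x a b)) ->
  (forall x a1 b1 a2 b2 : R, 0 < x < l ->
     `|f x a2 b2 - f x a1 b1| <= l2 x * `|a2 - a1| + l3 x * `|b2 - b1|) ->
  measurable_fun (`]0, l[%classic : set RR) (u : RR -> RR) ->
  measurable_fun (`]0, l[%classic : set RR) (v : RR -> RR) ->
  exists2 h : RR -> RR, measurable_fun (`]0, l[%classic : set RR) h &
    ae_eq_on l (fun x => f x (u x) (v x)) h.
Proof.
move=> fL flip mu mv; have mD : measurable (`]0, l[%classic : set RR) by [].
have /choice [H HP] : forall ab : R * R, exists h : RR -> RR,
    measurable_fun (`]0, l[%classic : set RR) h /\
    ae_eq_on l (fun x => f x ab.1 ab.2) h.
  by move=> [a b]; have [h [mh _] gh] := in_Lp2_sqi (fL a b); exists h.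
pose pt (k : int * int * nat) : R * R :=
  (k.1.1%:~R / k.2.+1%:R, k.1.2%:~R / k.2.+1%:R).
have [N [mN N0 sN]] : \forall x \ae leb, forall n : nat,
    if @unpickle (int * int * nat)%type n is Some k then
      `]0, l[%classic x -> f x (pt k).1 (pt k).2 = H (pt k) x else True.
  apply/ae_foralln => n; case: unpickle => [k|]; last exact: aeW.
  exact: (HP (pt k)).2.
have HN x n : ~ N x -> 0 < x < l -> f x (grid n (u x)) (grid n (v x)) =
    H (grid n (u x), grid n (v x)) x.
  move=> Nx xl; apply: contrapT => E; apply: Nx; apply: sN => /= HH; apply: E.
  have := HH (pickle (Num.floor (u x * n.+1%:R), Num.floor (v x * n.+1%:R), n)).
  by rewrite pickleK; apply; rewrite /= in_itv.
have mNC : measurable (~` N) by exact: measurableC.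
pose hn n : RR -> RR := (fun x : RR => H (grid n (u x), grid n (v x)) x) \_ (~` N).
pose h : RR -> RR := (fun x : RR => f x (u x) (v x) : RR) \_ (~` N).
exists h; last first.
  exists N; split => // x /= Hx; apply: contrapT => Nx; apply: Hx => _.
  by rewrite /h patchE mem_set.
apply: (@measurable_fun_cvg _ _ _ _ hn).
- move=> n; apply/(measurable_restrict _ mNC mD).
  apply: (measurable_funS mD); first exact: subIsetl.
  apply: (@measurable_fun_int2 _ (fun i j => H (i%:~R / n.+1%:R, j%:~R / n.+1%:R))
    (fun x => u x * n.+1%:R : RR) (fun x => v x * n.+1%:R : RR)) => //.
  + by move=> i j; exact: (HP _).1.
  + exact: measurable_funM.
  + exact: measurable_funM.
- move=> x /=; rewrite in_itv /= => xl; rewrite /hn /h patchE.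
  case: ifPn => [/set_mem Nx|Nx]; last first.
    by apply: cvg_near_cst; apply: nearW => n; rewrite patchE (negbTE Nx).
  have -> : (fun n => ((fun x : RR => H (grid n (u x), grid n (v x)) x) \_ (~` N)) x) =
      (fun n => f x (grid n (u x)) (grid n (v x))).
    by apply/funext => n; rewrite patchE mem_set// HN.
  have gN t : (fun n => `|t - grid n t|) @ \oo --> 0.
    rewrite -(normr0 R) -(subrr t); apply: cvg_norm; apply: cvgB.
      exact: cvg_cst.
    exact: grid_cvg.
  have c2 : (fun n => l2 x * `|u x - grid n (u x)| + l3 x * `|v x - grid n (v x)|)
      @ \oo --> 0.
    rewrite [X in _ --> X](_ : 0 = l2 x * 0 + l3 x * 0); last by rewrite !mulr0 addr0.
    by apply: cvgD; (apply: cvgM; [exact: cvg_cst|exact: gN]).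
  apply/cvgrPdist_le => e e0; have /cvgrPdist_le /(_ e e0) := c2.
  apply: filterS => n; rewrite sub0r normrN; apply: le_trans.
  by apply: le_trans (ler_norm _); exact: flip.
Qed.

End LpFacts.

(** * Weak derivatives and regularity of the solution *)

Section Weak.
Context {R : realType}.
Local Notation leb := (@lebesgue_measure R).
Local Notation RR := (measurableTypeR R).
Implicit Types (l : R) (g h u v V : R -> R).

Lemma ae_eq_on_refl l g : ae_eq_on l g g.
Proof. exact: aeW. Qed.

Lemma null_setU (A B : set RR) : measurable A -> measurable B ->
  leb A = 0%E -> leb B = 0%E -> leb (A `|` B) = 0%E.
Proof. by move=> mA mB A0 B0; rewrite measureU0. Qed.

Lemma ae_eq_on_map2 l (F : R -> R -> R -> R) g1 g2 h1 h2 :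
  ae_eq_on l g1 h1 -> ae_eq_on l g2 h2 ->
  ae_eq_on l (fun x => F x (g1 x) (g2 x)) (fun x => F x (h1 x) (h2 x)).
Proof.
move=> [N [mN N0 sN]] [N' [mN' N0' sN']]; exists (N `|` N'); split.
- exact: measurableU.
- by rewrite measureU0.
move=> x /= Hx; have [Nx|Nx] := pselect (N x); [by left|right].
apply: sN' => /= H'; apply: Hx => xl; rewrite (H' xl); congr (F _ _ _).
by apply: contrapT => fg; apply: Nx; apply: sN => /= /(_ xl).
Qed.

Lemma integral_ae_mul l g h phi : ae_eq_on l g h ->
  \int[leb]_(x in `]0, l[) (g x * phi x) = \int[leb]_(x in `]0, l[) (h x * phi x).
Proof.
by move=> gh; apply: Rintegral_ae;
  apply: (ae_eq_on_map2 (fun x a _ => a * phi x) gh gh).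
Qed.

(** Thanks to the fundamental lemma, the arbitrary choice made by [xget] in [weak_deriv] matters
    only on a null set. *)
Lemma weak_deriv_unique l n v g1 g2 : is_weak_deriv l n v g1 ->
  is_weak_deriv l n v g2 -> ae_eq_on l g1 g2.
Proof.
move=> [L1 H1] [L2 H2].
have mD : measurable (`]0, l[%classic : set RR) by [].
have [h1 /sqi_intg i1 e1] := in_Lp2_sqi L1.
have [h2 /sqi_intg i2 e2] := in_Lp2_sqi L2.
have H : ae_eq_on l (fun x => h1 x - h2 x) (cst 0).
  apply: fundamental_lemma; first exact: intgB.
  move=> phi tphi; have [cphi _ _] := test_function_C1 tphi.
  have I h : intg `]0, l[ h -> intg `]0, l[ (fun x => h x * phi x).
    by move=> ih; apply: (eq_intg mD _ (intg_mul_continuous cphi ih)) => x _;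
      exact: mulrC.
  have -> : \int[leb]_(x in `]0, l[) ((h1 x - h2 x) * phi x) =
      \int[leb]_(x in `]0, l[) (h1 x * phi x) -
      \int[leb]_(x in `]0, l[) (h2 x * phi x).
    by rewrite -RintegralB//; [apply: eq_Rintegral => x _; ring|exact: I..].
  rewrite -(integral_ae_mul phi e1) -(integral_ae_mul phi e2).
  by rewrite -H1// -H2// subrr.
have H12 : ae_eq_on l h1 h2.
  have := ae_eq_on_map2 (fun _ a b => a + b) H (ae_eq_on_refl l h2).
  by apply: filterS; [exact: (ae_filter_ringOfSetsType leb)|
    move=> x /= + xl => /(_ xl); rewrite subrK add0r].
exact: ae_eq_on_trans e1 (ae_eq_on_trans H12 (ae_eq_on_sym e2)).
Qed.

Lemma weak_derivP l n v g : is_weak_deriv l n v g ->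
  is_weak_deriv l n v (weak_deriv l n v).
Proof.
move=> Hg; rewrite /weak_deriv.
by apply: (@xgetPex _ (cst 0) [set g | is_weak_deriv l n v g]); exists g.
Qed.

Lemma weak_deriv_ae l n v g : is_weak_deriv l n v g ->
  ae_eq_on l (weak_deriv l n v) g.
Proof. by move=> Hg; exact: weak_deriv_unique (weak_derivP Hg) Hg. Qed.

Lemma sobolev_norm_nrm l n v g : is_weak_deriv l n v g -> sobolev_norm l n v = nrm l g.
Proof.
move=> /weak_deriv_ae Hg; rewrite /sobolev_norm /nrm; congr Num.sqrt.
apply: Rintegral_ae.
exact: (ae_eq_on_map2 (fun _ a _ => a ^+ 2) Hg Hg).
Qed.

Lemma continuous_weak_deriv0 l v V : continuous V -> ae_eq_on l v V ->
  is_weak_deriv l 0 v V.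
Proof.
move=> cV vV; split.
  exact: sqi_in_Lp2 (continuous_sqi 0 l cV) (ae_eq_on_refl l V).
by move=> phi tphi; rewrite expr0 mul1r derive1n0; exact: integral_ae_mul.
Qed.

Lemma C1_weak_deriv1 l v V V' : 0 < l -> C1_on l V V' -> ae_eq_on l v V ->
  is_weak_deriv l 1 v V'.
Proof.
move=> l0 CV vV; have [cV cV' _] := CV; split.
  exact: sqi_in_Lp2 (continuous_sqi 0 l cV') (ae_eq_on_refl l V').
move=> phi tphi; rewrite expr1 mulN1r derive1n1 (integral_ae_mul _ vV).
by rewrite (test_integral_parts l0 tphi CV) opprK.
Qed.

(** K0 h has weak second derivative -h and zero boundary values, so V + K0 h falls under the
    homogeneous lemma. *)
Lemma du_bois_reymond_K0 l V h : 0 < l -> continuous V -> V 0 = 0 -> V l = 0 ->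
  intg `]0, l[ h ->
  (forall phi, test_function l phi ->
     \int[leb]_(x in `]0, l[) (V x * derive1 (derive1 phi) x) =
     \int[leb]_(x in `]0, l[) (h x * phi x)) ->
  forall x, 0 <= x <= l -> V x = - K0 l h x.
Proof.
move=> l0 cV V0 Vl ih H x xl.
have cK := K0_continuous l0 ih; have [K00 K0l] := K0_boundary h l0.
apply/eqP; rewrite -addr_eq0; apply/eqP; move: x xl.
apply: (@du_bois_reymond2 _ l (fun x => V x + K0 l h x)) => //.
- by move=> y; exact: continuousD (cV y) (cK y).
- by rewrite V0 K00 addr0.
- by rewrite Vl K0l addr0.
move=> phi tphi.
have [_ cp'' _] := test_function_C1 (test_function_derive tphi).
have I F : continuous (F : R -> R) ->
    intg `]0, l[ (fun x => F x * derive1 (derive1 phi) x).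
  by move=> cF; apply: intg_mul_continuous => //; exact: intg_continuous.
have -> : \int[leb]_(x in `]0, l[) ((V x + K0 l h x) * derive1 (derive1 phi) x) =
  \int[leb]_(x in `]0, l[) (V x * derive1 (derive1 phi) x) +
  \int[leb]_(x in `]0, l[) (K0 l h x * derive1 (derive1 phi) x).
  by rewrite -RintegralD//; [apply: eq_Rintegral => x _; ring|exact: I..].
have := Kop_weak l0 (fundamental_pair0 l0) ih tphi.
by rewrite -/(K0 l h) (H _ tphi) => ->; rewrite mul0r sub0r subrr.
Qed.

(** * Superposition operators and regularity of the exact solution *)

Record nemytskii l (f : R -> R -> R -> R) (s1 s2 s3 l2 l3 : R -> R) : Prop := {
  nem_L2 : forall a b : R, in_Lp l 2%:E (fun x => f x a b);
  nem_growth : forall x a b : R, 0 < x < l ->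
    `|f x a b| <= s1 x + s2 x * `|a| + s3 x * `|b|;
  nem_lip : forall x a1 b1 a2 b2 : R, 0 < x < l ->
    `|f x a2 b2 - f x a1 b1| <= l2 x * `|a2 - a1| + l3 x * `|b2 - b1|;
  nem_s1 : in_Lp l 2%:E s1;
  nem_s2 : in_Lp l +oo%E s2;
  nem_s3 : in_Lp l +oo%E s3;
  nem_l2 : in_Lp l +oo%E l2;
  nem_l3 : in_Lp l +oo%E l3 }.

Lemma nemytskii_sqi l f (s1 s2 s3 l2 l3 U V : R -> R) :
  nemytskii l f s1 s2 s3 l2 l3 -> continuous U -> continuous V ->
  exists h, [/\ sqi `]0, l[ h, ae_eq_on l (fun x => f x (U x) (V x)) h &
    nrm l h <= Lp_norm l 2%:E s1 + Lp_norm l +oo%E s2 * nrm l U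
      + Lp_norm l +oo%E s3 * nrm l V].
Proof.
move=> [fL2 fgr flip ls1 ls2 ls3 _ _] cU cV.
have mD : measurable (`]0, l[%classic : set RR) by [].
have [h mh fh] := caratheodory fL2 flip
  (continuous_measurable_on mD cU) (continuous_measurable_on mD cV).
have [s ss es] := in_Lp2_sqi ls1.
set c2 := Lp_norm l +oo%E s2; set c3 := Lp_norm l +oo%E s3.
have sU := sqi_norm (continuous_sqi 0 l cU).
have sV := sqi_norm (continuous_sqi 0 l cV).
pose B x := s x + c2 * `|U x| + c3 * `|V x|.
have sB : sqi `]0, l[ B.
  by apply: sqiD => //; [apply: sqiD => //; exact: sqiZ|exact: sqiZ].
have hB : {ae leb, forall x : R, `]0, l[%classic x -> `|h x| <= B x}.
  have := Lp_normoo_ge ls2; have := Lp_normoo_ge ls3.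
  move=> [N3 [mN3 N30 sN3]] [N2 [mN2 N20 sN2]].
  have [N1 [mN1 N10 sN1]] := es; have [N0 [mN0 N00 sN0]] := fh.
  exists (N0 `|` N1 `|` (N2 `|` N3)); split.
  - by repeat apply: measurableU.
  - by apply: null_setU; [exact: measurableU..|exact: null_setU|exact: null_setU].
  move=> x /= Hx; apply: contrapT => /not_orP[/not_orP[n0 n1] /not_orP[n2 n3]].
  apply: Hx => xD.
  have [e0 e1] : f x (U x) (V x) = h x /\ s1 x = s x.
    split; apply: contrapT => E; [apply: n0; apply: sN0|apply: n1; apply: sN1];
      by move=> /= /(_ xD).
  have [b2 b3] : `|s2 x| <= c2 /\ `|s3 x| <= c3.
    split; apply: contrapT => E; [apply: n2; apply: sN2|apply: n3; apply: sN3];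
      by move=> /= /(_ xD).
  have xl : 0 < x < l by move: xD; rewrite in_itv.
  rewrite -e0 (le_trans (fgr _ _ _ xl))//.
  rewrite /B e1 lerD// ?lerD2l ?ler_wpM2r//.
  - by rewrite (le_trans (ler_norm _)).
  - by rewrite (le_trans (ler_norm _)).
have [sh nh] := nrm_ae_le mh sB hB.
exists h; split => //; apply: (le_trans nh).
rewrite (Lp_norm2 ss es).
apply: (le_trans (nrmD (sqiD mD ss (sqiZ c2 mD sU)) (sqiZ c3 mD sV))).
rewrite !nrmZ// !nrm_norm !ger0_norm ?Lp_norm_ge0// lerD2r.
apply: (le_trans (nrmD ss (sqiZ c2 mD sU))).
by rewrite nrmZ// nrm_norm ger0_norm ?Lp_norm_ge0.
Qed.

Lemma nemytskii_sub l f (s1 s2 s3 l2 l3 U1 V1 h1 U2 V2 h2 : R -> R) :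
  nemytskii l f s1 s2 s3 l2 l3 ->
  continuous U1 -> continuous V1 -> continuous U2 -> continuous V2 ->
  sqi `]0, l[ h1 -> sqi `]0, l[ h2 ->
  ae_eq_on l (fun x => f x (U1 x) (V1 x)) h1 ->
  ae_eq_on l (fun x => f x (U2 x) (V2 x)) h2 ->
  nrm l (fun x => h1 x - h2 x) <=
    Lp_norm l +oo%E l2 * nrm l (fun x => U1 x - U2 x) +
    Lp_norm l +oo%E l3 * nrm l (fun x => V1 x - V2 x).
Proof.
move=> [_ _ flip _ _ _ ll2 ll3] cU1 cV1 cU2 cV2 sh1 sh2 e1 e2.
have mD : measurable (`]0, l[%classic : set RR) by [].
set c2 := Lp_norm l +oo%E l2; set c3 := Lp_norm l +oo%E l3.
have cU : continuous (fun x => U1 x - U2 x).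
  by move=> x; exact: continuousB (cU1 x) (cU2 x).
have cV : continuous (fun x => V1 x - V2 x).
  by move=> x; exact: continuousB (cV1 x) (cV2 x).
have sU := sqi_norm (continuous_sqi 0 l cU).
have sV := sqi_norm (continuous_sqi 0 l cV).
pose B x := c2 * `|U1 x - U2 x| + c3 * `|V1 x - V2 x|.
have sB : sqi `]0, l[ B by apply: sqiD => //; exact: sqiZ.
have hB : {ae leb, forall x : R, `]0, l[%classic x -> `|h1 x - h2 x| <= B x}.
  have := Lp_normoo_ge ll2; have := Lp_normoo_ge ll3.
  move=> [N3 [mN3 N30 sN3]] [N2 [mN2 N20 sN2]].
  have [N1 [mN1 N10 sN1]] := e2; have [N0 [mN0 N00 sN0]] := e1.
  exists (N0 `|` N1 `|` (N2 `|` N3)); split.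
  - by repeat apply: measurableU.
  - by apply: null_setU; [exact: measurableU..|exact: null_setU|exact: null_setU].
  move=> x /= Hx; apply: contrapT => /not_orP[/not_orP[n0 n1] /not_orP[n2 n3]].
  apply: Hx => xD.
  have [E0 E1] : f x (U1 x) (V1 x) = h1 x /\ f x (U2 x) (V2 x) = h2 x.
    split; apply: contrapT => E; [apply: n0; apply: sN0|apply: n1; apply: sN1];
      by move=> /= /(_ xD).
  have [b2 b3] : `|l2 x| <= c2 /\ `|l3 x| <= c3.
    split; apply: contrapT => E; [apply: n2; apply: sN2|apply: n3; apply: sN3];
      by move=> /= /(_ xD).
  have xl : 0 < x < l by move: xD; rewrite in_itv.
  rewrite -E0 -E1 (le_trans (flip _ _ _ _ _ xl))//.
  rewrite /B lerD// ler_wpM2r//.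
  - by rewrite (le_trans (ler_norm _)).
  - by rewrite (le_trans (ler_norm _)).
have [_ nh] := nrm_ae_le (sqiB mD sh1 sh2).1 sB hB.
apply: (le_trans nh).
apply: (le_trans (nrmD (sqiZ c2 mD sU) (sqiZ c3 mD sV))).
by rewrite !nrmZ// !nrm_norm !ger0_norm ?Lp_norm_ge0.
Qed.

Lemma zero_boundary_rep l v : 0 < l -> zero_boundary_values l v ->
  exists V, [/\ continuous V, ae_eq_on l v V, V 0 = 0 & V l = 0].
Proof.
move=> l0 [w [cw vw w0 wl]]; exists (w \o clamp l); split.
- exact: continuous_comp_clamp.
- apply: ae_eq_on_trans vw _; apply: aeW => x /=; rewrite in_itv /= => /andP[x0 xl].
  by rewrite clamp_id// !ltW.
- by rewrite /= clamp_id// lexx ltW.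
- by rewrite /= clamp_id// lexx ltW.
Qed.

(** The representation by K0 is used twice. Applied to u, with the continuous representative [W] of
    u'', it gives U = - K0 W, hence a C^2 function; applied to W - tau U, whose weak second
    derivative is [h], it gives U'' = tau U - K0 h. The second use relies on the boundary values of
    u''. *)
Lemma solution_regularity l m f (s1 s2 s3 l2 l3 : R -> R) u : 0 < l ->
  nemytskii l f s1 s2 s3 l2 l3 -> is_solution l m f u ->
  exists U U' h, [/\ beam_sol l (m (nrm l U' ^+ 2)) h U U', sqi `]0, l[ h,
    ae_eq_on l u U & ae_eq_on l (fun x => f x (U x) (U' x)) h].
Proof.
move=> l0 nem [[_ wd] _ weq zu zu''].
have [U [cU uU U0 Ul]] := zero_boundary_rep l0 zu.
have [W [cW uW W0 Wl]] := zero_boundary_rep l0 zu''.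
have iW : intg `]0, l[ W by exact: intg_continuous.
have [g2 Hg2] := wd 2%N isT; have [_ Hu2] := weak_derivP Hg2.
have HU phi : test_function l phi ->
    \int[leb]_(x in `]0, l[) (U x * derive1 (derive1 phi) x) =
    \int[leb]_(x in `]0, l[) (W x * phi x).
  move=> tphi; have := Hu2 _ tphi.
  by rewrite sqrrN expr1n mul1r (integral_ae_mul _ uU) (integral_ae_mul _ uW).
have UE := du_bois_reymond_K0 l0 cU U0 Ul iW HU.
have [z' Cz Cz'] := K0_C2 l0 cW.
pose U' x := -1 * z' x.
have CU : C1_on l U U'.
  have [_ c d] := C1_on_scale (-1) Cz; split => //.
  have UE' x : 0 < x < l -> -1 * K0 l W x = U x.
    by move=> /andP[x0 xl]; rewrite UE ?mulN1r// !ltW.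
  exact: (is_derive_eq_itv UE' d).
have CU' : C1_on l U' W.
  have [c1 c2 d] := C1_on_scale (-1) Cz'; split => // x xl.
  by apply: is_derive_eq (d x xl) _; rewrite mulN1r opprK.
have [_ cU' _] := CU.
have u1 := weak_deriv_ae (C1_weak_deriv1 l0 CU uU).
have [h [sh fh _]] := nemytskii_sqi nem cU cU'.
have fuh : ae_eq_on l (fun x => f x (u x) (weak_deriv l 1 u x)) h.
  exact: ae_eq_on_trans (ae_eq_on_map2 f uU u1) fh.
have ih := sqi_intg sh.
set tau := m _ in weq.
have tauE : tau = m (nrm l U' ^+ 2).
  rewrite /tau nrm_sqr; congr m; apply: Rintegral_ae.
  exact: (ae_eq_on_map2 (fun _ a _ => a ^+ 2) u1 u1).
exists U, U', h; rewrite -tauE; split => //; split => //.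
have cV : continuous (fun x => W x - tau * U x).
  move=> x; apply: (@continuousB _ _ _ W (fun x => tau * U x)); first exact: cW.
  by apply: continuousM (cU x); exact: cst_continuous.
have HV phi : test_function l phi ->
    \int[leb]_(x in `]0, l[) ((W x - tau * U x) * derive1 (derive1 phi) x) =
    \int[leb]_(x in `]0, l[) (h x * phi x).
  move=> tphi; have [_ cp'' _] := test_function_C1 (test_function_derive tphi).
  have I F : continuous (F : R -> R) ->
      intg `]0, l[ (fun x => F x * derive1 (derive1 phi) x).
    by move=> cF; apply: intg_mul_continuous => //; exact: intg_continuous.
  (* Testing u'' = W against phi'' trades the fourth derivative of [phi] for the second. *)
  have E4 := HU _ (test_function_derive (test_function_derive tphi)).
  have E4' := integral_ae_mul (derive1 (derive1 (derive1 (derive1 phi)))) uU.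
  have E2 := integral_ae_mul (derive1 (derive1 phi)) uU.
  transitivity (\int[leb]_(x in `]0, l[) (W x * derive1 (derive1 phi) x) -
      tau * \int[leb]_(x in `]0, l[) (U x * derive1 (derive1 phi) x)); last first.
    apply: etrans (etrans _ (weq _ tphi)) (integral_ae_mul phi fuh).
    exact: (congr2 (fun a b => a - tau * b) (esym (etrans E4' E4)) (esym E2)).
  clear weq tauE Hu2 HU E4 E4' E2.
  rewrite -RintegralZl//; last exact: I.
  rewrite -RintegralB//; [|exact: I|by apply: intgZ => //; exact: I].
  by apply: eq_Rintegral => x _; rewrite mulrBl mulrA.
have V0 : W 0 - tau * U 0 = 0 by rewrite W0 U0 mulr0 subr0.
have Vl : W l - tau * U l = 0 by rewrite Wl Ul mulr0 subr0.
have VE := du_bois_reymond_K0 l0 cV V0 Vl ih HV.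
have [c1 c2 d] := CU'; split => //.
  move=> x; apply: (@continuousB _ _ _ (fun x => tau * U x) (K0 l h)).
    by apply: continuousM (cU x); exact: cst_continuous.
  exact: K0_continuous.
move=> x /[dup] xl /andP[x0 x1]; apply: is_derive_eq (d x xl) _.
have := VE x; rewrite !ltW// => /(_ isT) H.
by rewrite -[K0 l h x]opprK -H; ring.
Qed.

End Weak.

(** * The Picard iteration *)

Section Picard.
Context {R : realType}.
Local Notation leb := (@lebesgue_measure R).
Local Notation RR := (measurableTypeR R).
Implicit Types (l : R) (g h u v V : R -> R).

Lemma has_deriv_on_near l v g x e : 0 < e -> has_deriv_on l v g -> 0 <= x <= l ->
  exists2 d, 0 < d & forall y, `|x - y| < d -> y != x -> 0 <= y <= l ->
    `|g x - (v y - v x) / (y - x)| < e.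
Proof.
move=> e0 vg xl; have /vg : x \in `[0, l] by rewrite in_itv.
move=> /cvgrPdist_lt /(_ e e0) /nbhs_ballP [d d0 H]; by exists d.
Qed.

Lemma has_deriv_on_continuous l v g : has_deriv_on l v g ->
  {within `[0, l], continuous v}.
Proof.
move=> vg; apply/subspace_continuousP => x /=; rewrite in_itv /= => xl.
have [d d0 H] := has_deriv_on_near ltr01 vg xl.
apply/cvgrPdist_lt => e e0; set K := `|g x| + 1.
have K0 : 0 < K by rewrite ltr_wpDl.
apply/nbhs_ballP; exists (Num.min d (e / K)) => /=.
  by rewrite lt_min d0 divr_gt0.
move=> y /=; rewrite /ball /= lt_min => /andP[xy xye]; rewrite in_itv /= => yl.
have [->|yx] := eqVneq y x; first by rewrite subrr normr0.
have {}H := H y xy yx yl.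
have yx0 : y - x != 0 by rewrite subr_eq0.
rewrite -normrN opprB -[v y - v x](divfK yx0) normrM [`|y - x|]distrC.
have /le_lt_trans : `|(v y - v x) / (y - x)| * `|x - y| <= K * `|x - y|.
  apply: ler_wpM2r => //; rewrite -[X in `|X|](subKr (g x)).
  by rewrite (le_trans (ler_normB _ _))// lerD2l ltW.
by apply; rewrite mulrC -ltr_pdivlMr.
Qed.

Lemma has_deriv_on_is_derive l v g x : has_deriv_on l v g -> 0 < x < l ->
  is_derive x 1 v (g x).
Proof.
move=> vg /andP[x0 xl].
have C : (fun h : R => h^-1 *: ((v \o shift x) (h *: 1) - v x)) @ 0^' --> g x.
  apply/cvgrPdist_lt => e e0.
  have [|d d0 H] := has_deriv_on_near (x := x) e0 vg; first by rewrite !ltW.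
  apply/nbhs_ballP; exists (Num.min d (Num.min x (l - x))) => /=.
    by rewrite !lt_min d0 x0 subr_gt0.
  move=> h /=; rewrite /ball /= sub0r normrN !lt_min => /and3P[hd hx hl] h0.
  have -> : h^-1 *: (v (h *: 1 + x) - v x) = (v (x + h) - v x) / (x + h - x).
    by rewrite [h *: _]mulr1 [h + x]addrC [x + h - x]addrC addKr mulrC.
  rewrite ltr_norml in hx; rewrite ltr_norml in hl; apply: H.
  - by rewrite opprD addNKr normrN.
  - by rewrite -subr_eq0 [x + h]addrC addrK.
  - by apply/andP; split; lra.
by apply: DeriveDef; [apply/cvg_ex; exists (g x)|exact: cvg_lim].
Qed.

Lemma admissible_C1 l u0 : 0 < l -> admissible l u0 ->
  exists V V', [/\ C1_on l V V', V 0 = 0, V l = 0 &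
    forall x, 0 < x < l -> u0 x = V x /\ derive1 u0 x = V' x].
Proof.
move=> l0 [u1 [u2 [d01 d12 _ [z0 zl] _]]].
exists (u0 \o clamp l), (u1 \o clamp l).
have xx x : 0 < x < l -> 0 <= x <= l by move=> /andP[? ?]; rewrite !ltW.
have D x : 0 < x < l -> is_derive x 1 u0 ((u1 \o clamp l) x).
  by move=> xl; rewrite /= clamp_id ?xx//; exact: has_deriv_on_is_derive d01 xl.
split.
- split; [exact: continuous_comp_clamp (has_deriv_on_continuous d01)|
    exact: continuous_comp_clamp (has_deriv_on_continuous d12)|].
  apply: (is_derive_eq_itv _ D) => x xl; by rewrite /= clamp_id ?xx.
- by rewrite /= clamp_id// lexx ltW.
- by rewrite /= clamp_id// lexx ltW.
- move=> x xl; split; first by rewrite /= clamp_id ?xx.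
  by rewrite derive1E; case: (D x xl).
Qed.

(** The energy estimate with sigma = 0, that is, a comparison with the zero function. [V] is the
    function at which the right-hand side is evaluated: the previous iterate, or [W] itself for the
    exact solution. *)
Lemma beam_apriori l alpha tau (c1 c2 c3 : R) h (V V' W W' : R -> R) : 0 < l ->
  alpha <= tau -> 0 <= c2 -> beam_sol l tau h W W' -> sqi `]0, l[ h ->
  C1_on l V V' -> V 0 = 0 -> V l = 0 ->
  nrm l h <= c1 + c2 * nrm l V + c3 * nrm l V' ->
  (alpha + (pi / l) ^+ 2) * nrm l W' <=
    l / pi * (c1 + (l / pi * c2 + c3) * nrm l V').
Proof.
move=> l0 at_ c20 [CW CW' W0 Wl] sh CV V0 Vl hb.
have l_pi : 0 < l / pi :> R by rewrite divr_gt0 ?pi_gt0.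
have CW'' : C1_on l W' (fun x => tau * W x + 0 * W x - K0 l h x).
  by rewrite (_ : (fun x => _) = fun x => tau * W x - K0 l h x)//; apply/funext => x;
    rewrite mul0r addr0.
have := energy_lower l0 at_ CW CW'' W0 Wl CW W0 Wl sh.
rewrite normr0 mul0r addr0 => /le_trans; apply; rewrite ler_pM2l//.
apply: (le_trans hb); have := ler_wpM2l c20 (wirtinger l0 CV V0 Vl); lra.
Qed.

Lemma beam_sub l alpha tau tau' h h' (W W' U U' : R -> R) : 0 < l ->
  alpha <= tau -> beam_sol l tau h W W' -> beam_sol l tau' h' U U' ->
  sqi `]0, l[ h -> sqi `]0, l[ h' ->
  (alpha + (pi / l) ^+ 2) * nrm l (fun x => W' x - U' x) <=
    l / pi * nrm l (fun x => h x - h' x) + `|tau - tau'| * nrm l U'.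
Proof.
move=> l0 at_ [CW CW' W0 Wl] [CU CU' U0 Ul] sh sh'.
have mD : measurable (`]0, l[%classic : set RR) by [].
have CD := C1_on_sub CW CU.
have := C1_on_sub CW' CU'.
(* The splitting keeps tau >= alpha in front of the difference, and leaves tau - tau' multiplying
   the fixed function [U]. *)
rewrite (_ : (fun x => tau * W x - _ - _) = fun x =>
  tau * (W x - U x) + (tau - tau') * U x - K0 l (fun y => h y - h' y) x); last first.
  apply/funext => x; rewrite (K0_sub l0 (sqi_intg sh) (sqi_intg sh')); ring.
move=> CD'; apply: (energy_lower l0 at_ CD CD' _ _ CU U0 Ul (sqiB mD sh sh')).
- by rewrite W0 U0 subrr.
- by rewrite Wl Ul subrr.
Qed.

(** Stated for one step from an arbitrary [v]: with [v] the k-th iterate, [picard l m f v 1] is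
    convertible to the iterate of index k.+1. The iterate is tied to [W] only inside ]0, l[, which
    suffices for its derivative there. *)
Lemma picard_step l alpha m f (s1 s2 s3 l2 l3 V V' v : R -> R) : 0 < l -> 0 < alpha ->
  (forall z : R, 0 <= z -> alpha <= m z) ->
  nemytskii l f s1 s2 s3 l2 l3 ->
  C1_on l V V' ->
  (forall x, 0 < x < l -> v x = V x /\ derive1 v x = V' x) ->
  exists W W' h, [/\ beam_sol l (m (nrm l V' ^+ 2)) h W W', sqi `]0, l[ h,
    ae_eq_on l (fun x => f x (V x) (V' x)) h,
    nrm l h <= Lp_norm l 2%:E s1 + Lp_norm l +oo%E s2 * nrm l V
      + Lp_norm l +oo%E s3 * nrm l V' &
    forall x, 0 < x < l ->
      picard l m f v 1 x = W x /\ derive1 (picard l m f v 1) x = W' x].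
Proof.
move=> l0 a0 ma nem CV vV; have [cV cV' _] := CV.
have [h [sh fh hb]] := nemytskii_sqi nem cV cV'.
set tau := m (nrm l V' ^+ 2).
have tau0 : 0 < tau by apply: lt_le_trans a0 (ma _ _); exact: sqr_ge0.
have [W' BW] := Top_beam l0 tau0 (sqi_intg sh).
have taue : m (\int[leb]_(x in `]0, l[) (derive1 v x) ^+ 2) = tau.
  rewrite /tau nrm_sqr; congr m; apply: eq_Rintegral => x.
  by rewrite inE /= in_itv /= => /vV [_ ->].
have pW x : 0 < x < l -> picard l m f v 1 x = Top l tau h x.
  move=> /[dup] xl /andP[x0 xl']; rewrite -(Top_green l0 tau0 (sqi_intg sh)); last first.
    by rewrite !ltW.
  rewrite /= taue; apply: Rintegral_ae; case: fh => N [mN N0 sN]; exists N; split => //.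
  move=> y /= H; apply: sN => /= H'; apply: H => yl; rewrite -(H' yl).
  by move: yl; rewrite in_itv /= => /vV [-> ->].
exists (Top l tau h), W', h; split => // x xl; split; first exact: pW.
have [[_ _ dW] _ _ _] := BW.
have /(_ x xl) [_] := is_derive_eq_itv (fun y yl => esym (pW y yl)) dW.
by rewrite derive1E.
Qed.

Lemma apriori_fixed_point (b K c1 c w y : R) : w = b - K * c -> 0 < w ->
  b * y <= K * (c1 + c * y) -> y <= K * c1 / w.
Proof. by move=> we w0 H; rewrite ler_pdivlMr// we; lra. Qed.

(** The radius r = K c1 / w is the fixed point of the affine bound: b r = K (c1 + c r). So the ball
    of this radius, where the iteration starts, is never left. *)
Lemma apriori_invariant (b K c1 c w x y : R) : w = b - K * c -> 0 < w -> 0 < b ->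
  0 <= K -> 0 <= c -> x <= K * c1 / w -> b * y <= K * (c1 + c * x) -> y <= K * c1 / w.
Proof.
move=> we w0 b0 K0 c0 xB /le_trans H; rewrite -(ler_pM2l b0); apply: H.
have BE : K * c1 / w * w = K * c1 by rewrite divfK// gt_eqF.
have := ler_wpM2l (mulr_ge0 K0 c0) xB; rewrite we in BE *; lra.
Qed.

(** Matches [contraction_factor] with the two terms of the energy estimate, for K = l/pi, z =
    |sigma1| / omega and e = |V' - U'|. *)
Lemma contraction_identity (b K l1 z c4 c5 e : R) : b != 0 -> K != 0 ->
  b * (b^-1 * K ^+ 2 * (2 * l1 * z ^+ 2 + c4 + K^-1 * c5) * e) =
  K * ((c4 * K + c5) * e) + l1 * (2 * (K * z) ^+ 2 * e).
Proof. by move=> b0 K0; field; rewrite b0 K0. Qed.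

Lemma picard_contraction l alpha l1 m f (s1 s2 s3 l2 l3 U U' hU V V' W W' hW : R -> R) :
  let B := l / (omega l alpha s2 s3 * pi) * Lp_norm l 2%:E s1 in
  0 < l -> 0 < alpha -> (forall z : R, 0 <= z -> alpha <= m z) -> 0 < l1 ->
  (forall z1 z2 : R, 0 <= z1 -> 0 <= z2 -> `|m z1 - m z2| <= l1 * `|z2 - z1|) ->
  nemytskii l f s1 s2 s3 l2 l3 -> 0 < omega l alpha s2 s3 ->
  beam_sol l (m (nrm l U' ^+ 2)) hU U U' -> sqi `]0, l[ hU ->
  ae_eq_on l (fun x => f x (U x) (U' x)) hU -> nrm l U' <= B ->
  C1_on l V V' -> V 0 = 0 -> V l = 0 -> nrm l V' <= B ->
  beam_sol l (m (nrm l V' ^+ 2)) hW W W' -> sqi `]0, l[ hW ->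
  ae_eq_on l (fun x => f x (V x) (V' x)) hW ->
  nrm l (fun x => W' x - U' x) <=
    contraction_factor l alpha l1 s1 s2 s3 l2 l3 * nrm l (fun x => V' x - U' x).
Proof.
move=> B l0 a0 ma l10 mlip nem w0 BU sU eU UB CV V0 Vl VB BW sW eW.
have [CU _ U0 Ul] := BU; have [cU cU' _] := CU; have [cV cV' _] := CV.
have pi0 : 0 < pi :> R by exact: pi_gt0.
have H := beam_sub l0 (ma _ (sqr_ge0 (nrm l V'))) BW BU sW sU.
have Hf := nemytskii_sub nem cV cV' cU cU' sW sU eW eU.
have := wirtinger l0 (C1_on_sub CV CU); rewrite V0 U0 Vl Ul subrr => /(_ erefl erefl).
have Ht := mlip _ _ (sqr_ge0 (nrm l V')) (sqr_ge0 (nrm l U')).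
rewrite [X in l1 * X]distrC in Ht.
have := nrm_sqr_sub (continuous_sqi 0 l cV') (continuous_sqi 0 l cU').
have b0 : 0 < alpha + (pi / l) ^+ 2 by rewrite addr_gt0// exprn_gt0// divr_gt0.
have [c40 c50] := (Lp_norm_ge0 l +oo%E l2, Lp_norm_ge0 l +oo%E l3).
move: w0 UB VB Ht Hf H c40 c50; rewrite /B /contraction_factor.
have := nrm_ge0 l U'; have := nrm_ge0 l (fun x => V' x - U' x).
set e := nrm l (fun x => V' x - U' x); set d := nrm l (fun x => V x - U x).
set u := nrm l U'; set v := nrm l V'; set c4 := Lp_norm l _ l2; set c5 := Lp_norm l _ l3.
set w := omega _ _ _ _; set S := Lp_norm l _ s1; set dm := `|m _ - _|; set n := nrm l _.
set y := nrm l _; set b := alpha + _; set t := `|_ - _|.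
move=> e0 u0 w0 uB vB Ht Hn H c40 c50 tb dK.
set K := l / pi in H dK *.
have K0 : 0 < K by rewrite divr_gt0.
have Bw : l / (w * pi) * S = K * (S / w).
  by rewrite /K invfM; ring.
rewrite Bw in uB vB; set C := K * (S / w) in uB vB.
(* [t] is the change of the squared norm, at most e (v + u); as [u] and [v] are at most [C], the
   further factor [u] yields 2 C^2 e. *)
have tB : t * u <= 2 * C ^+ 2 * e.
  have C0 : 0 <= C by exact: le_trans u0 uB.
  apply: (@le_trans _ _ (e * (C + C) * C)); last lra.
  apply: ler_pM => //; first exact: normr_ge0.
  by apply: (le_trans tb); rewrite ler_wpM2l// lerD.
rewrite -(ler_pM2l b0); apply: (le_trans H).
have -> : b * (b^-1 * K ^+ 2 * (2 * l1 * (S / w) ^+ 2 + c4 + pi / l * c5) * e) =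
    K * ((c4 * K + c5) * e) + l1 * (2 * C ^+ 2 * e).
  by rewrite -[pi / l]invf_div -/K; apply: contraction_identity; rewrite gt_eqF.
apply: lerD.
  rewrite ler_pM2l//; apply: (le_trans Hn).
  by rewrite mulrDl lerD// -mulrA ler_wpM2l.
by apply: (le_trans (ler_wpM2r u0 Ht)); rewrite -[l1 * t * u]mulrA ler_pM2l.
Qed.

End Picard.

(** * Convergence and the error estimate *)

Theorem theorem1 (R : realType) (l alpha l1 : R) (m : R -> R)
    (f : R -> R -> R -> R) (sigma1 sigma2 sigma3 l2 l3 : R -> R)
    (u u0 : R -> R)
    (l_gt0 : 0 < l)
    (alpha_gt0 : 0 < alpha)
    (m_ge : forall z : R, 0 <= z -> alpha <= m z)
    (l1_gt0 : 0 < l1)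
    (m_lip : forall z1 z2 : R, 0 <= z1 -> 0 <= z2 ->
       `|m z1 - m z2| <= l1 * `|z2 - z1|)
    (f_L2 : forall a b : R, in_Lp l 2%:E (fun x => f x a b))
    (f_growth : forall x a b : R, 0 < x < l ->
       `|f x a b| <= sigma1 x + sigma2 x * `|a| + sigma3 x * `|b|)
    (f_lip : forall x a1 b1 a2 b2 : R, 0 < x < l ->
       `|f x a2 b2 - f x a1 b1| <= l2 x * `|a2 - a1| + l3 x * `|b2 - b1|)
    (sigma1_L2 : in_Lp l 2%:E sigma1)
    (sigma2_Loo : in_Lp l +oo%E sigma2)
    (sigma3_Loo : in_Lp l +oo%E sigma3)
    (l2_Loo : in_Lp l +oo%E l2)
    (l3_Loo : in_Lp l +oo%E l3)
    (sigma1_ge : exists2 c : R, 0 < c & forall x : R, 0 < x < l -> c <= sigma1 x)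
    (sigma2_ge0 : forall x : R, 0 < x < l -> 0 <= sigma2 x)
    (sigma3_ge0 : forall x : R, 0 < x < l -> 0 <= sigma3 x)
    (l2_gt0 : forall x : R, 0 < x < l -> 0 < l2 x)
    (l3_gt0 : forall x : R, 0 < x < l -> 0 < l3 x)
    (omega_gt0 : 0 < omega l alpha sigma2 sigma3)
    (u_sol : is_solution l m f u)
    (u0_adm : admissible l u0)
    (u0_small : sobolev_norm l 1 u0 <=
       l / (omega l alpha sigma2 sigma3 * pi) * Lp_norm l 2%:E sigma1)
    (q_lt1 : contraction_factor l alpha l1 sigma1 sigma2 sigma3 l2 l3 < 1) :
  (forall p : nat, (p <= 1)%N ->
     (fun k => sobolev_norm l p (picard l m f u0 k \- u)) @ \oo --> 0) /\
  (forall k p : nat, (1 <= k)%N -> (p <= 1)%N ->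
     sobolev_norm l p (picard l m f u0 k \- u) <=
       (l / pi) ^+ (1 - p)
       * contraction_factor l alpha l1 sigma1 sigma2 sigma3 l2 l3 ^+ k
       * sobolev_norm l 1 (u0 \- u)).
Proof.
have nem : nemytskii l f sigma1 sigma2 sigma3 l2 l3 by split.
have [U [U' [hU [BU sU uU eU]]]] := solution_regularity l_gt0 nem u_sol.
have [V0 [V0' [CV0 V00 V0l u0V]]] := admissible_C1 l_gt0 u0_adm.
have [CU _ U0 Ul] := BU; have [cU cU' _] := CU.
have pi0 : 0 < pi :> R by exact: pi_gt0.
set K := l / pi; have K0 : 0 < K by rewrite divr_gt0.
set q := contraction_factor _ _ _ _ _ _ _ _ in q_lt1 *.
set S := Lp_norm l 2%:E sigma1 in u0_small; set w := omega _ _ _ _ in omega_gt0 u0_small.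
set c2 := Lp_norm l +oo%E sigma2; set c3 := Lp_norm l +oo%E sigma3.
have c20 : 0 <= c2 by exact: Lp_norm_ge0.
have c30 : 0 <= c3 by exact: Lp_norm_ge0.
pose b := alpha + (pi / l) ^+ 2; pose c := K * c2 + c3.
have b0 : 0 < b by rewrite addr_gt0// exprn_gt0// divr_gt0.
have c0 : 0 <= c by rewrite addr_ge0// mulr_ge0// ltW.
have we : w = b - K * c by [].
have BE : l / (w * pi) * S = K * S / w.
  by rewrite /K invfM; ring.
have q0 : 0 <= q.
  apply: mulr_ge0; first by rewrite mulr_ge0 ?sqr_ge0// invr_ge0 ltW.
  have l1S : 0 <= 2 * l1 * (S / w) ^+ 2 by rewrite mulr_ge0 ?sqr_ge0// mulr_ge0// ltW.
  by rewrite !addr_ge0 ?Lp_norm_ge0// mulr_ge0 ?Lp_norm_ge0// ltW// divr_gt0.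
(* A second representative of the right-hand side at [U], which comes with the growth bound; it
   agrees with [hU] almost everywhere, so the norms coincide. *)
have [hU' [sU' eU' hbU]] := nemytskii_sqi nem cU cU'.
have UB : nrm l U' <= l / (w * pi) * S.
  rewrite BE; apply: (apriori_fixed_point we omega_gt0).
  apply: (beam_apriori l_gt0 (m_ge _ (sqr_ge0 (nrm l U'))) c20 BU sU CU U0 Ul).
  suff -> : nrm l hU = nrm l hU' by [].
  congr Num.sqrt; apply: Rintegral_ae.
  have hh := ae_eq_on_trans (ae_eq_on_sym eU) eU'.
  exact: (ae_eq_on_map2 (fun _ a _ => a ^+ 2) hh hh).
have sob1 v V V' : C1_on l V V' -> (forall x, 0 < x < l -> v x = V x) ->
    sobolev_norm l 1 (v \- u) = nrm l (fun x => V' x - U' x).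
  move=> CV vV; apply/sobolev_norm_nrm/(C1_weak_deriv1 l_gt0 (C1_on_sub CV CU)).
  case: uU => N [mN N0 sN]; exists N; split => // x /= H; apply: sN => /= H'.
  by apply: H => xl; rewrite (H' xl) vV.
have sob0 v V V' : C1_on l V V' -> (forall x, 0 < x < l -> v x = V x) ->
    sobolev_norm l 0 (v \- u) = nrm l (fun x => V x - U x).
  move=> CV vV; apply/sobolev_norm_nrm/continuous_weak_deriv0.
    by case: (C1_on_sub CV CU).
  case: uU => N [mN N0 sN]; exists N; split => // x /= H; apply: sN => /= H'.
  by apply: H => xl; rewrite (H' xl) vV.
pose e0 := nrm l (fun x => V0' x - U' x).
(* The bound on [nrm l V'] is carried along because the contraction is available only inside that
   ball. *)
have inv k : exists V V', [/\ C1_on l V V', V 0 = 0 /\ V l = 0,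
    forall x, 0 < x < l -> picard l m f u0 k x = V x /\ derive1 (picard l m f u0 k) x = V' x,
    nrm l V' <= l / (w * pi) * S & nrm l (fun x => V' x - U' x) <= q ^+ k * e0].
  elim: k => [|k [V [V' [CV [Vz Vl] pV VB Ve]]]].
    exists V0, V0'; split => //; last by rewrite expr0 mul1r.
    rewrite -(sobolev_norm_nrm (C1_weak_deriv1 (v := u0) l_gt0 CV0 _))//.
    by apply: aeW => x /=; rewrite in_itv /= => /u0V [].
  have [W [W' [h [BW sW eW hb pW]]]] := picard_step l_gt0 alpha_gt0 m_ge nem CV pV.
  have [CW _ W0 Wl] := BW; exists W, W'; split => //.
  - rewrite BE; rewrite BE in VB; apply: (apriori_invariant we _ b0 _ c0 VB) => //.
      exact: ltW.
    exact: (beam_apriori l_gt0 (m_ge _ (sqr_ge0 (nrm l V'))) c20 BW sW CV Vz Vl).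
  - rewrite exprS -mulrA; apply: (le_trans (picard_contraction l_gt0 alpha_gt0 m_ge l1_gt0
      m_lip nem omega_gt0 BU sU eU UB CV Vz Vl VB BW sW eW)).
    by rewrite ler_wpM2l.
have e0E : sobolev_norm l 1 (u0 \- u) = e0 by apply: sob1 CV0 _ => x /u0V [].
have est k p : (p <= 1)%N ->
    sobolev_norm l p (picard l m f u0 k \- u) <= K ^+ (1 - p) * q ^+ k * e0.
  have [V [V' [CV [Vz Vl] pV _ Ve]]] := inv k.
  have pV1 x : 0 < x < l -> picard l m f u0 k x = V x by move=> /pV [].
  case: p => [|[|//]] _.
    rewrite (sob0 _ _ _ CV pV1) subn0 expr1 -mulrA.
    apply: (@le_trans _ _ (K * nrm l (fun x => V' x - U' x))); last by rewrite ler_pM2l.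
    by apply: (wirtinger l_gt0 (C1_on_sub CV CU)); rewrite ?Vz ?U0 ?Vl ?Ul subrr.
  by rewrite (sob1 _ _ _ CV pV1) subnn expr0 mul1r.
split=> [p p1|k p _ p1]; last by rewrite e0E; exact: est.
(* Convergence follows from the estimate itself, as 0 <= q < 1. *)
apply: (@squeeze_cvgr _ _ _ _ (cst 0) (fun k => K ^+ (1 - p) * e0 * q ^+ k)).
- by apply: nearW => k; rewrite sqrtr_ge0 mulrAC est.
- exact: cvg_cst.
- rewrite -[X in _ --> X](mulr0 (K ^+ (1 - p) * e0)); apply: cvgMr.
  by apply: cvg_expr; rewrite ger0_norm.
Qed.
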